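(* Let $R$ be a basic finite dimensional algebra over an algebraically closed field $K$ with complete set of orthogonal primitive idempotents $\{e_1,\dots,e_m\}$ and quiver $Q$, let $\varphi:KQ\to R$ be the surjective $K$-algebra homomorphism described in the context, and let $\{\rho_1,\dots,\rho_w\}$ be a set of basic elements of $KQ$ generating the two-sided ideal $\mathrm{Ker}\,\varphi$ of $KQ$. Let $n_1,\dots,n_m\ge 1$ be natural numbers, let $P=R(n_1,\dots,n_m)$ be the block extension of $R$, let $Q'$ be the quiver of $P$ described in the context, and let $e:KQ_+\to KQ'_+$ be the extension map. Then there is a $K$-algebra isomorphism $$P\simeq KQ'/(e(\rho_1),\dots,e(\rho_w)).$$
   Context: Algebras are finite dimensional associative unital algebras over an algebraically closed field $K$ (path algebras excepted); $J(-)$ denotes the Jacobson radical. $R$ is basic if the modules $e_iR$ are pairwise non-isomorphic. Put $Q_i=e_iRe_i$ and $A_{ij}=e_iRe_j$ for $i\ne j$. Put $X_{ii}=J(Q_i)^2+\sum_{k\ne i}A_{ik}A_{ki}$ and, for $i\neq j$, $X_{ij}=J(Q_i)A_{ij}+A_{ij}J(Q_j)+\sum_{k\ne i,j}A_{ik}A_{kj}$. Put $d_{ii}=\dim_K J(Q_i)/X_{ii}$ and $d_{ij}=\dim_K A_{ij}/X_{ij}$ for $i\ne j$. The quiver $Q$ of $R$ has vertices $1,\dots,m$ and $d_{ij}$ arrows $\alpha^1_{ij},\dots,\alpha^{d_{ij}}_{ij}$ from $i$ to $j$. Path algebras: the path algebra $KQ$ has as basis all paths (including the trivial path at each vertex);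 the product $pq$ of paths is the concatenation ''first $p$, then $q$'' if $p$ ends where $q$ starts, and $0$ otherwise. $KQ_+$ (resp. $KQ'_+$) is the $K$-subspace spanned by all paths of length $\ge 1$. An element of $KQ$ is basic if all paths appearing in it have the same source and the same target. Fix elements $x^1_{ij},\dots,x^{d_{ij}}_{ij}$ of $J(Q_i)$ (if $i=j$) or of $A_{ij}$ (if $i\ne j$) whose classes form a $K$-basis of $J(Q_i)/X_{ii}$, resp. $A_{ij}/X_{ij}$. The homomorphism $\varphi:KQ\to R$ sends the trivial path at $i$ to $e_i$ and $\alpha^t_{ij}$ to $x^t_{ij}\in e_iRe_j$; it is surjective. Block extension: for $1\le i,s\le m$, $1\le j\le n_i$, $1\le t\le n_s$ put $P_{ij,st}=Q_i$ if $i=s$ and $j\le t$; $P_{ij,st}=J(Q_i)$ if $i=s$ and $j>t$; $P_{ij,st}=A_{is}$ if $i\ne s$. The block extension $P=R(n_1,\dots,n_m)$ is the algebra of all matrices with rows and columns indexed by the pairs $(i,j)$, $1\le i\le m$, $1\le j\le n_i$, whose $(ij,st)$-entry lies in $P_{ij,st}$, with the usual matrix multiplication. Quiver $Q'$: its vertices are the pairs $(i,j)$ with $1\le i\le m$, $1\le j\le n_i$; its arrows are one arrow $\delta_{ij}:(i,j)\to(i,j+1)$ for each $1\le i\le m$, $1\le j\le n_i-1$, and $d_{is}$ arrows $\beta^1_{is},\dots,\beta^{d_{is}}_{is}$ from $(i,n_i)$ to $(s,1)$ for each $1\le i,s\le m$. Extension map: put $\delta_i=\delta_{i1}\delta_{i2}\cdots\delta_{i,n_i-1}\in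 KQ'$ (the trivial path at $(i,1)$ if $n_i=1$). The extension map $e:KQ_+\to KQ'_+$ is the $K$-linear map sending a path $p=\alpha^{t_1}_{i_1i_2}\alpha^{t_2}_{i_2i_3}\cdots\alpha^{t_k}_{i_ki_{k+1}}$ ($k\ge1$) to $$e(p)=\beta^{t_1}_{i_1i_2}\,\delta_{i_2}\,\beta^{t_2}_{i_2i_3}\,\delta_{i_3}\cdots\beta^{t_{k-1}}_{i_{k-1}i_k}\,\delta_{i_k}\,\beta^{t_k}_{i_ki_{k+1}}.$$ (One has $\mathrm{Ker}\,\varphi\subset KQ_+$, so $e(\rho_i)$ is defined.) $(e(\rho_1),\dots,e(\rho_w))$ denotes the two-sided ideal of $KQ'$ generated by these elements. *)

(* Defs.v *)
From HB Require Import structures.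
From mathcomp Require Import all_boot all_order all_algebra all_field.
From mathcomp Require Import boolp finmap monalg.

Set Implicit Arguments.
Unset Strict Implicit.
Unset Printing Implicit Defensive.

Import GRing.Theory.

Local Open Scope ring_scope.

Definition two_sided_ideal (A : pzRingType) (I : A -> Prop) : Prop :=
  [/\ I 0,
      forall a b, I a -> I b -> I (a + b),
      forall a b, I b -> I (a * b) &
      forall a b, I a -> I (a * b)].

Definition ideal_gen (A : pzRingType) (S : A -> Prop) : {pred A} :=
  fun a => `[< forall I : A -> Prop,
                 two_sided_ideal I -> (forall s, S s -> I s) -> I a >].

Section Ideals.
Variables (A : pzRingType) (S : A -> Prop).

Lemma ideal_genP : two_sided_ideal (ideal_gen S).
Proof.
split=> [|a b /asboolP Ia /asboolP Ib|a b /asboolP Ib|a b /asboolP Ia];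
  apply/asboolP => I II SI; have [I0 ID Il Ir] := II => //.
- by apply: ID; [apply: Ia | apply: Ib].
- by apply: Il; apply: Ib.
- by apply: Ir; apply: Ia.
Qed.

Lemma mem_ideal_gen a : S a -> ideal_gen S a.
Proof. by move=> Sa; apply/asboolP => I _; apply. Qed.

Fact ideal_gen_zmod_closed : zmod_closed (ideal_gen S).
Proof.
have [I0 ID Il _] := ideal_genP; split=> // a b Ia Ib.
by apply: ID => //; rewrite -mulN1r; apply: Il.
Qed.
HB.instance Definition _ := GRing.isZmodClosed.Build A (ideal_gen S)
  ideal_gen_zmod_closed.

End Ideals.

Record quiver := Quiver {
  vertex : finType;
  arrow : finType;
  src : arrow -> vertex;
  tgt : arrow -> vertex
}.
Arguments src {q}.
Arguments tgt {q}.

(* The path with source [v] traversing the arrows of [s] in this order. *)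
Fixpoint is_path (Q : quiver) (v : vertex Q) (s : seq (arrow Q)) : bool :=
  if s is a :: s' then (src a == v) && is_path (tgt a) s' else true.

Record qpath (Q : quiver) := QPath {
  path_val : vertex Q * seq (arrow Q);
  _ : is_path path_val.1 path_val.2
}.
HB.instance Definition _ (Q : quiver) := [isSub for @path_val Q].
HB.instance Definition _ (Q : quiver) := [Choice of qpath Q by <:].

Section Paths.
Variable Q : quiver.
Implicit Types p q : qpath Q.

Definition psrc p : vertex Q := (path_val p).1.
Definition parrows p : seq (arrow Q) := (path_val p).2.
Definition pend (v : vertex Q) (s : seq (arrow Q)) := last v (map tgt s).
Definition ptgt p : vertex Q := pend (psrc p) (parrows p).

Definition triv_path (v : vertex Q) : qpath Q :=
  @QPath Q (v, [::]) isT.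

Fact arrow_path_subproof (a : arrow Q) : is_path (src a) [:: a].
Proof. by rewrite /= eqxx. Qed.
Definition arrow_path (a : arrow Q) : qpath Q :=
  @QPath Q (src a, [:: a]) (arrow_path_subproof a).

Lemma is_path_cat v s t :
  is_path v (s ++ t) = is_path v s && is_path (pend v s) t.
Proof. by elim: s v => //= a s IHs v; rewrite IHs andbA. Qed.

Fact concat_path_subproof p q :
  ptgt p = psrc q -> is_path (psrc p) (parrows p ++ parrows q).
Proof.
move=> pq; rewrite is_path_cat; apply/andP; split; first exact: (valP p).
by change (is_path (ptgt p) (parrows q)); rewrite pq; exact: (valP q).
Qed.

Definition concat_path p q : option (qpath Q) :=
  if @eqP _ (ptgt p) (psrc q) is ReflectT pq then
    Some (@QPath Q (psrc p, parrows p ++ parrows q) (concat_path_subproof pq))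
  else None.

Lemma concat_pathP p q r : concat_path p q = Some r <->
  ptgt p = psrc q /\ path_val r = (psrc p, parrows p ++ parrows q).
Proof.
rewrite /concat_path; case: eqP => [pq|npq]; split=> //.
- by case=> <-.
- by case=> _ rE; congr Some; apply: val_inj.
- by case.
Qed.

Lemma concat_path_eq_None p q : concat_path p q = None <-> ptgt p <> psrc q.
Proof. by rewrite /concat_path; case: eqP. Qed.

Lemma ptgt_concat p q r : concat_path p q = Some r -> ptgt r = ptgt q.
Proof.
case/concat_pathP => pq rE.
have -> : ptgt r = pend (ptgt p) (parrows q).
  by rewrite /ptgt /psrc /parrows rE /pend /= map_cat last_cat.
by rewrite pq.
Qed.

Lemma psrc_concat p q r : concat_path p q = Some r -> psrc r = psrc p.
Proof. by case/concat_pathP => _ rE; rewrite /psrc rE. Qed.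

Lemma concat_pathA p q r :
  obind (concat_path p) (concat_path q r) =
  obind (concat_path^~ r) (concat_path p q).
Proof.
apply/eqP; case E1: (concat_path q r) => [qr|] /=;
  case E2: (concat_path p q) => [pq|] //=.
- have [e1 v1] := (concat_pathP _ _ _).1 E1.
  have [e2 v2] := (concat_pathP _ _ _).1 E2.
  have [u eu] : exists u, concat_path pq r = Some u.
    rewrite /concat_path; case: eqP => [?|[]]; first by eexists.
    by rewrite (ptgt_concat E2).
  rewrite eu; have [_ vu] := (concat_pathP _ _ _).1 eu.
  apply/eqP/concat_pathP; rewrite (psrc_concat E1); split=> //.
  by rewrite vu /psrc /parrows v1 v2 /= catA.
- apply/eqP/concat_path_eq_None.
  by rewrite (psrc_concat E1); apply/concat_path_eq_None.
- apply/eqP; symmetry; apply/concat_path_eq_None.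
  by rewrite (ptgt_concat E2); apply/concat_path_eq_None.
Qed.

Lemma concat_triv_path v p :
  concat_path (triv_path v) p = if psrc p == v then Some p else None.
Proof.
case: eqP => [pv|npv].
  by apply/concat_pathP; split=> //=; rewrite -pv; apply: surjective_pairing.
by apply/concat_path_eq_None => /= e; apply: npv.
Qed.

Lemma concat_path_triv v p :
  concat_path p (triv_path v) = if ptgt p == v then Some p else None.
Proof.
case: eqP => [pv|npv].
  by apply/concat_pathP; split=> //=; rewrite cats0; apply: surjective_pairing.
exact/concat_path_eq_None.
Qed.

End Paths.

(* The finitely supported functions from paths to K: [a@_p] is the coefficient
   in a of the path p, and [msupp a] the finite set of the paths appearing in a.
   The operations are locked because conversion problems that unfold the
   underlying finitely supported functions are intractable. *)
Definition path_alg (K : fieldType) (Q : quiver) := {malg K[qpath Q]}.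
HB.instance Definition _ K Q := Choice.on (path_alg K Q).

HB.lock Definition pa_zero (K : fieldType) (Q : quiver) : path_alg K Q := 0 : {malg K[qpath Q]}.
HB.lock Definition pa_opp (K : fieldType) (Q : quiver) (a : path_alg K Q) : path_alg K Q :=
  - (a : {malg K[qpath Q]}).
HB.lock Definition pa_add (K : fieldType) (Q : quiver) (a b : path_alg K Q) : path_alg K Q :=
  (a : {malg K[qpath Q]}) + (b : {malg K[qpath Q]}).
HB.lock Definition pa_scale (K : fieldType) (Q : quiver) (c : K) (a : path_alg K Q) : path_alg K Q :=
  c *: (a : {malg K[qpath Q]}).

HB.lock Definition pa_path (K : fieldType) (Q : quiver) (p : qpath Q) : path_alg K Q := << p >>.
Arguments pa_path K {Q} p.

Section PathAlgebraModule.
Variables (K : fieldType) (Q : quiver).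
Local Notation A := (path_alg K Q).
Implicit Types (a b : A) (c : K) (p q : qpath Q).

Let paE := (pa_zero.unlock, pa_opp.unlock, pa_add.unlock, pa_scale.unlock).

Fact pa_addA : associative (@pa_add K Q).
Proof. by move=> x y z; rewrite !paE addrA. Qed.
Fact pa_addC : commutative (@pa_add K Q).
Proof. by move=> x y; rewrite !paE addrC. Qed.
Fact pa_add0 : left_id (@pa_zero K Q) (@pa_add K Q).
Proof. by move=> x; rewrite !paE add0r. Qed.
Fact pa_addN : left_inverse (@pa_zero K Q) (@pa_opp K Q) (@pa_add K Q).
Proof. by move=> x; rewrite !paE addNr. Qed.
HB.instance Definition _ := GRing.isZmodule.Build A
  pa_addA pa_addC pa_add0 pa_addN.

Fact pa_scaleA c d a :
  pa_scale c (pa_scale d a) = pa_scale (c * d) a.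
Proof. by rewrite !paE scalerA. Qed.
Fact pa_scale1 : left_id 1 (@pa_scale K Q).
Proof. by move=> a; rewrite !paE scale1r. Qed.
Fact pa_scaleDr : right_distributive (@pa_scale K Q) (@pa_add K Q).
Proof. by move=> c a b; rewrite !paE scalerDr. Qed.
Fact pa_scaleDl a : {morph (@pa_scale K Q)^~ a : c d / c + d >-> pa_add c d}.
Proof. by move=> c d; rewrite !paE scalerDl. Qed.
HB.instance Definition _ := GRing.Zmodule_isLmodule.Build K A
  pa_scaleA pa_scale1 pa_scaleDr pa_scaleDl.

Lemma pa_coef0 p : (0 : A)@_p = 0.
Proof. by rewrite -[0 : A]/(pa_zero K Q) pa_zero.unlock mcoeff0. Qed.
Lemma pa_coefD a b p : (a + b)@_p = a@_p + b@_p.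
Proof. by rewrite -[a + b]/(pa_add a b) pa_add.unlock mcoeffD. Qed.
Lemma pa_coefZ c a p : (c *: a)@_p = c * a@_p.
Proof. by rewrite -[c *: a]/(pa_scale c a) pa_scale.unlock mcoeffZ. Qed.
Lemma pa_coef_path p q : (pa_path K p)@_q = (p == q)%:R.
Proof. by rewrite pa_path.unlock mcoeffU. Qed.

Lemma pa_eqP a b : (forall p, a@_p = b@_p) -> a = b.
Proof. by move=> h; apply/malgP. Qed.

Lemma pa_coef_sum I (r : seq I) (P : pred I) (F : I -> A) p :
  (\sum_(i <- r | P i) F i)@_p = \sum_(i <- r | P i) (F i)@_p.
Proof.
exact: (big_morph (fun a : A => a@_p) (fun a b => pa_coefD a b p) (pa_coef0 p)).
Qed.

Lemma pa_sumE a : a = \sum_(p <- msupp a) a@_p *: pa_path K p.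
Proof.
apply: pa_eqP => q; rewrite pa_coef_sum.
have [qa|qa] := boolP (q \in msupp a); last first.
  rewrite (mcoeff_outdom qa) big_seq big1 // => p pa.
  rewrite pa_coefZ pa_coef_path; case: eqP => [pq|_]; last by rewrite mulr0.
  by rewrite -pq pa in qa.
rewrite (bigD1_seq q) ?fset_uniq //= pa_coefZ pa_coef_path eqxx mulr1.
rewrite big1 ?addr0 // => p /negPf pq.
by rewrite pa_coefZ pa_coef_path pq mulr0.
Qed.

End PathAlgebraModule.

HB.lock Definition lin_ext (K : fieldType) (Q : quiver) (V : lmodType K)
    (h : qpath Q -> V) (a : path_alg K Q) : V :=
  \sum_(p <- msupp a) a@_p *: h p.

Section LinearExtension.
Variables (K : fieldType) (Q : quiver) (V : lmodType K).
Implicit Types (h : qpath Q -> V) (a b : path_alg K Q).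

Lemma lin_extw h a (D : {fset qpath Q}) : (msupp a `<=` D)%fset ->
  lin_ext h a = \sum_(p <- D) a@_p *: h p.
Proof.
move=> sD; rewrite lin_ext.unlock.
apply: big_fset_incl => // p _ /mcoeff_outdom ->.
by rewrite scale0r.
Qed.

Fact lin_ext_is_linear h : linear (lin_ext h : path_alg K Q -> V).
Proof.
move=> c a b.
pose D := (msupp a `|` msupp b `|` msupp (c *: a + b))%fset.
rewrite (@lin_extw h a D) ?(@lin_extw h b D) ?(@lin_extw h _ D).
- rewrite scaler_sumr -big_split; apply: eq_bigr => p _ /=.
  by rewrite pa_coefD pa_coefZ scalerDl scalerA.
- by apply/fsubsetP => q; rewrite !in_fsetU => ->; rewrite ?orbT.
- by apply/fsubsetP => q; rewrite !in_fsetU => ->; rewrite ?orbT.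
- by apply/fsubsetP => q; rewrite !in_fsetU => ->; rewrite ?orbT.
Qed.
HB.instance Definition _ h :=
  GRing.isLinear.Build K (path_alg K Q) V *:%R (lin_ext h)
    (lin_ext_is_linear h).

Lemma lin_ext_path h p : lin_ext h (pa_path K p) = h p.
Proof.
rewrite (@lin_extw h _ [fset p]%fset); last by rewrite pa_path.unlock msuppU_le.
by rewrite big_seq_fset1 pa_coef_path eqxx scale1r.
Qed.

Lemma eq_lin_ext h h' : h =1 h' -> lin_ext (K := K) h =1 lin_ext h'.
Proof. by move=> e a; rewrite lin_ext.unlock; apply: eq_bigr => p _; rewrite e. Qed.

Lemma path_alg_lin_eq (f g : path_alg K Q -> V) :
  linear f -> linear g ->
  (forall p, f (pa_path K p) = g (pa_path K p)) -> f =1 g.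
Proof.
have sumE (h : path_alg K Q -> V) : linear h -> forall a,
    h a = \sum_(p <- msupp a) a@_p *: h (pa_path K p).
  move=> lh a; pose H := GRing.isLinear.Build K (path_alg K Q) V *:%R h lh.
  pose h' : {linear path_alg K Q -> V} := HB.pack h H.
  rewrite {1}[a]pa_sumE -[LHS]/(h' _) linear_sum.
  by apply: eq_bigr => p _; rewrite linearZ.
by move=> lf lg fg a; rewrite sumE // [RHS]sumE //; apply: eq_bigr => p _;
  rewrite fg.
Qed.

End LinearExtension.

Definition path_mul (K : fieldType) (Q : quiver) (p q : qpath Q) :
    path_alg K Q :=
  if concat_path p q is Some r then pa_path K r else 0.

HB.lock Definition pa_one (K : fieldType) (Q : quiver) : path_alg K Q :=
  \sum_(v : vertex Q) pa_path K (triv_path v).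
HB.lock Definition pa_mul (K : fieldType) (Q : quiver) (a b : path_alg K Q) :
    path_alg K Q :=
  lin_ext (fun p => lin_ext (path_mul K p) b) a.

Section PathAlgebra.
Variables (K : fieldType) (Q : quiver).
Local Notation A := (path_alg K Q).
Implicit Types (a b c : A) (p q r : qpath Q).
Local Notation pa_path := (pa_path K).
Local Notation path_mul := (path_mul K).
Local Notation pa_mul := (@pa_mul K Q).
Local Notation pa_one := (pa_one K Q).

Lemma pa_mulUU p q : pa_mul (pa_path p) (pa_path q) = path_mul p q.
Proof. by rewrite pa_mul.unlock !lin_ext_path. Qed.

Fact pa_mul_linear_l b : linear (pa_mul^~ b).
Proof. by move=> k a a'; rewrite pa_mul.unlock linearP. Qed.
Fact pa_mul_linear_r a : linear (pa_mul a).
Proof.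
move=> k b b'.
have E c : pa_mul a c = \sum_(p <- msupp a) a@_p *: lin_ext (path_mul p) c.
  by rewrite pa_mul.unlock lin_ext.unlock.
rewrite !E scaler_sumr -big_split; apply: eq_bigr => p _ /=.
by rewrite linearP scalerDr !scalerA mulrC.
Qed.
Fact pa_mulDl : left_distributive pa_mul +%R.
Proof. by move=> a b c; have := pa_mul_linear_l c 1 a b; rewrite !scale1r. Qed.
Fact pa_mulDr : right_distributive pa_mul +%R.
Proof. by move=> a b c; have := pa_mul_linear_r a 1 b c; rewrite !scale1r. Qed.
Fact pa_mul0l b : pa_mul 0 b = 0.
Proof. by apply: (addrI (pa_mul 0 b)); rewrite -pa_mulDl !addr0. Qed.
Fact pa_mul0r a : pa_mul a 0 = 0.
Proof. by apply: (addrI (pa_mul a 0)); rewrite -pa_mulDr !addr0. Qed.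

Fact pa_mulZl k a b : k *: pa_mul a b = pa_mul (k *: a) b.
Proof.
by have := pa_mul_linear_l b k a 0; rewrite pa_mul0l [k *: a + 0]addr0 => ->;
  rewrite addr0.
Qed.
Fact pa_mulZr k a b : k *: pa_mul a b = pa_mul a (k *: b).
Proof.
by have := pa_mul_linear_r a k b 0; rewrite pa_mul0r [k *: b + 0]addr0 => ->;
  rewrite addr0.
Qed.

Fact pa_mulA : associative pa_mul.
Proof.
move=> a b c; move: a; apply: path_alg_lin_eq.
- exact: pa_mul_linear_l.
- by move=> k a a'; rewrite (pa_mul_linear_l b) (pa_mul_linear_l c).
move=> p; move: b; apply: path_alg_lin_eq.
- by move=> k b b'; rewrite (pa_mul_linear_l c) (pa_mul_linear_r (pa_path p)).
- by move=> k b b'; rewrite (pa_mul_linear_r (pa_path p)) (pa_mul_linear_l c).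
move=> q; move: c; apply: path_alg_lin_eq.
- by move=> k c c'; rewrite (pa_mul_linear_r (pa_path q)) (pa_mul_linear_r (pa_path p)).
- exact: pa_mul_linear_r.
move=> r; rewrite !pa_mulUU /path_mul; have := concat_pathA p q r.
case: (concat_path q r) => [qr|]; case: (concat_path p q) => [pq|] /= e.
- by rewrite !pa_mulUU /path_mul e.
- rewrite pa_mulUU /path_mul e.
  by rewrite pa_mul0l.
- by rewrite pa_mulUU /path_mul -e pa_mul0r.
- by rewrite pa_mul0l pa_mul0r.
Qed.

Fact pa_mul1 : left_id pa_one pa_mul.
Proof.
apply: path_alg_lin_eq => [||p]; [exact: pa_mul_linear_r|by []|].
have -> : pa_mul pa_one (pa_path p) =
    \sum_v pa_mul (pa_path (triv_path v)) (pa_path p).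
  by rewrite pa_one.unlock (big_morph (pa_mul^~ (pa_path p)) (id1 := 0) (op1 := +%R))
    // => [a b|]; rewrite ?pa_mulDl ?pa_mul0l.
rewrite (bigD1 (psrc p)) //= pa_mulUU /path_mul concat_triv_path eqxx.
rewrite big1 ?addr0 // => v vp.
by rewrite pa_mulUU /path_mul concat_triv_path eq_sym (negPf vp).
Qed.

Fact pa_mulr1 : right_id pa_one pa_mul.
Proof.
apply: path_alg_lin_eq => [||p]; [exact: pa_mul_linear_l|by []|].
rewrite pa_one.unlock (big_morph (pa_mul (pa_path p)) (id1 := 0) (op1 := +%R))
  ?pa_mul0r //; last exact: pa_mulDr.
rewrite (bigD1 (ptgt p)) //= pa_mulUU /path_mul concat_path_triv eqxx.
rewrite big1 ?addr0 // => v vp.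
by rewrite pa_mulUU /path_mul concat_path_triv eq_sym (negPf vp).
Qed.

HB.instance Definition _ := GRing.Zmodule_isPzRing.Build A
  pa_mulA pa_mul1 pa_mulr1 pa_mulDl pa_mulDr.

Lemma pa_scalerAl (k : K) (u v : A) : k *: (u * v) = (k *: u) * v.
Proof. exact: pa_mulZl. Qed.
Lemma pa_scalerAr (k : K) (u v : A) : k *: (u * v) = u * (k *: v).
Proof. exact: pa_mulZr. Qed.

Definition triv_elt (v : vertex Q) : A := pa_path (triv_path v).
Definition arrow_elt (x : arrow Q) : A := pa_path (arrow_path x).

Definition basic_elt a : Prop :=
  {in msupp a &, forall p q, psrc p = psrc q /\ ptgt p = ptgt q}.

End PathAlgebra.
Arguments triv_elt K {Q} v.
Arguments arrow_elt K {Q} x.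

(* [algType] requires 1 != 0, which the quotient below need not satisfy: a
   K-algebra is presented here by its [pzRingType] and [lmodType K] structures,
   with their compatibility stated as lemmas. *)
Section Quotient.
Variables (K : fieldType) (Q : quiver) (S : path_alg K Q -> Prop).
Local Notation A := (path_alg K Q).

Definition quot_alg : Type := @Quotient.quot A (ideal_gen S).

Definition quot_pi : A -> quot_alg := \pi_(@Quotient.quot A (ideal_gen S))%qT.

HB.instance Definition _ := GRing.Zmodule.on quot_alg.

Lemma quot_piP x y : reflect (quot_pi x = quot_pi y) (ideal_gen S (x - y)).
Proof.
have -> : ideal_gen S (x - y) = (quot_pi x == quot_pi y).
  exact: (@Quotient.idealrBE A (ideal_gen S)).
exact: eqP.
Qed.

Lemma quot_pi_surj z : exists a, z = quot_pi a.
Proof. by exists (repr z); rewrite /quot_pi reprK. Qed.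

Fact quot_pi_is_zmod_morphism : zmod_morphism quot_pi.
Proof. by move=> x y; rewrite /quot_pi piE. Qed.
HB.instance Definition _ := GRing.isZmodMorphism.Build A quot_alg quot_pi
  quot_pi_is_zmod_morphism.

Definition quot_one : quot_alg := quot_pi 1.
Definition quot_mul (x y : quot_alg) : quot_alg := quot_pi (repr x * repr y).
Definition quot_scale (c : K) (x : quot_alg) : quot_alg :=
  quot_pi (c *: repr x).

Lemma quot_reprP a : ideal_gen S (repr (quot_pi a) - a).
Proof. by apply/quot_piP; rewrite /quot_pi reprK. Qed.

Lemma quot_mulE a b : quot_mul (quot_pi a) (quot_pi b) = quot_pi (a * b).
Proof.
apply/quot_piP; have [_ ID Il Ir] := @ideal_genP A S.
set a' := repr _; set b' := repr _.
have -> : a' * b' - a * b = (a' - a) * b' + a * (b' - b).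
  by rewrite mulrBl mulrBr addrA subrK.
by apply: ID; [apply: Ir|apply: Il]; apply: quot_reprP.
Qed.

Lemma quot_scaleE c a : quot_scale c (quot_pi a) = quot_pi (c *: a).
Proof.
apply/quot_piP; have [_ _ Il _] := @ideal_genP A S.
rewrite -scalerBr -[_ - _]mul1r pa_scalerAl; apply: Il; exact: quot_reprP.
Qed.

Fact quot_mulA : associative quot_mul.
Proof.
move=> x y z; have [a ->] := quot_pi_surj x; have [b ->] := quot_pi_surj y.
by have [c ->] := quot_pi_surj z; rewrite !quot_mulE mulrA.
Qed.
Fact quot_mul1 : left_id quot_one quot_mul.
Proof. by move=> z; have [a ->] := quot_pi_surj z; rewrite quot_mulE mul1r. Qed.
Fact quot_mulr1 : right_id quot_one quot_mul.
Proof. by move=> z; have [a ->] := quot_pi_surj z; rewrite quot_mulE mulr1. Qed.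
Fact quot_mulDl : left_distributive quot_mul +%R.
Proof.
move=> x y z; have [a ->] := quot_pi_surj x; have [b ->] := quot_pi_surj y.
have [c ->] := quot_pi_surj z.
by rewrite -raddfD !quot_mulE -raddfD mulrDl.
Qed.
Fact quot_mulDr : right_distributive quot_mul +%R.
Proof.
move=> x y z; have [a ->] := quot_pi_surj x; have [b ->] := quot_pi_surj y.
have [c ->] := quot_pi_surj z.
by rewrite -raddfD !quot_mulE -raddfD mulrDr.
Qed.
HB.instance Definition _ := GRing.Zmodule_isPzRing.Build quot_alg
  quot_mulA quot_mul1 quot_mulr1 quot_mulDl quot_mulDr.

Fact quot_scaleA a b v :
  quot_scale a (quot_scale b v) = quot_scale (a * b) v.
Proof. by have [{}v ->] := quot_pi_surj v; rewrite !quot_scaleE scalerA. Qed.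
Fact quot_scale1 : left_id 1 quot_scale.
Proof. by move=> z; have [a ->] := quot_pi_surj z; rewrite quot_scaleE scale1r. Qed.
Fact quot_scaleDr : right_distributive quot_scale +%R.
Proof.
move=> c x y; have [a ->] := quot_pi_surj x; have [b ->] := quot_pi_surj y.
by rewrite -raddfD !quot_scaleE -raddfD scalerDr.
Qed.
Fact quot_scaleDl v : {morph quot_scale^~ v : a b / a + b}.
Proof.
by move=> a b; have [{}v ->] := quot_pi_surj v; rewrite !quot_scaleE -raddfD scalerDl.
Qed.
HB.instance Definition _ := GRing.Zmodule_isLmodule.Build K quot_alg
  quot_scaleA quot_scale1 quot_scaleDr quot_scaleDl.

Lemma quot_scalerAl (c : K) (u v : quot_alg) : c *: (u * v) = (c *: u) * v.
Proof.
have [{}u ->] := quot_pi_surj u; have [{}v ->] := quot_pi_surj v.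
change (quot_scale c (quot_mul (quot_pi u) (quot_pi v)) =
  quot_mul (quot_scale c (quot_pi u)) (quot_pi v)).
by rewrite quot_mulE !quot_scaleE quot_mulE pa_scalerAl.
Qed.
Lemma quot_scalerAr (c : K) (u v : quot_alg) : c *: (u * v) = u * (c *: v).
Proof.
have [{}u ->] := quot_pi_surj u; have [{}v ->] := quot_pi_surj v.
change (quot_scale c (quot_mul (quot_pi u) (quot_pi v)) =
  quot_mul (quot_pi u) (quot_scale c (quot_pi v))).
by rewrite quot_mulE !quot_scaleE quot_mulE pa_scalerAr.
Qed.

End Quotient.

Section Jacobson.
Variables (K : fieldType) (R : falgType K).
Implicit Types (B M U V W : {vspace R}).

(* A subalgebra B of R may have its own unit, different from that of R. Since B
   has a unit, its right ideals are automatically K-subspaces. *)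
Definition right_ideal B U : bool := ((U <= B) && (U * B <= U))%VS.

Definition maximal_right_ideal B M : Prop :=
  [/\ right_ideal B M, M != B &
      forall U, right_ideal B U -> (M <= U)%VS -> U = M \/ U = B].

Fact vspace_of_subproof (P : R -> Prop) : P 0 ->
  (forall k u v, P u -> P v -> P (k *: u + v)) ->
  exists W, forall x, x \in W <-> P x.
Proof.
move=> P0 PL; pose D n := `[< exists W, (forall x, x \in W -> P x) /\ \dim W = n >].
have D0 : exists n, D n.
  by exists 0%N; apply/asboolP; exists 0%VS; split=> [x|];
    rewrite ?dimv0 // memv0 => /eqP->.
have Dle n : D n -> (n <= \dim (fullv : {vspace R}))%N.
  by move=> /asboolP[W [_ <-]]; apply: dimvS; apply: subvf.
case: (ex_maxnP D0 Dle) => n /asboolP[W [WP dW]] nmax.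
exists W => x; split=> [|Px]; first exact: WP.
have : D (\dim (W + <[x]>)).
  apply/asboolP; exists (W + <[x]>)%VS; split=> // y /memv_addP[w wW [z]].
  by case/vlineP => k -> ->; rewrite addrC; apply: PL => //; apply: WP.
move=> /nmax; rewrite -dW => le.
have /eqP -> : W == (W + <[x]>)%VS by rewrite eqEdim addvSl.
by apply: (subvP (addvSr _ _)); apply: memv_line.
Qed.

Fact jacobson_subproof B : exists W, forall x,
  x \in W <-> (x \in B /\ forall M, maximal_right_ideal B M -> x \in M).
Proof.
apply: vspace_of_subproof => [|k u v [uB uM] [vB vM]].
  by split=> [|M _]; rewrite mem0v.
split=> [|M mM]; first by rewrite memvD ?memvZ.
by apply: memvD; [apply: memvZ; apply: uM | apply: vM].
Qed.

(* The intersection of all maximal right ideals of B. *)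
Definition jacobson B : {vspace R} := sval (cid (jacobson_subproof B)).

Lemma jacobsonP B x : x \in jacobson B <->
  (x \in B /\ forall M, maximal_right_ideal B M -> x \in M).
Proof. by rewrite /jacobson; case: cid => /=. Qed.

Lemma jacobson_sub B : (jacobson B <= B)%VS.
Proof. by apply/subvP => x /jacobsonP[]. Qed.

Lemma jacobson_mulr B x b : (B * B <= B)%VS ->
  x \in jacobson B -> b \in B -> x * b \in jacobson B.
Proof.
move=> BB /jacobsonP[xB xM] bB; apply/jacobsonP; split=> [|M mM].
  by apply: (subvP BB); apply: memv_mul.
have [/andP[_ /subvP MB] _ _] := mM.
by apply: MB; apply: memv_mul => //; apply: xM.
Qed.

Lemma jacobson_mull B x b : (B * B <= B)%VS ->
  b \in B -> x \in jacobson B -> b * x \in jacobson B.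
Proof.
move=> BB bB /jacobsonP[xB xM]; have BBs := subvP BB.
apply/jacobsonP; split=> [|M mM]; first by apply: BBs; apply: memv_mul.
have [/andP[MsB MB] MnB Mmax] := mM.
pose N := (B :&: amull b @^-1: M)%VS.
have NP y : y \in N = (y \in B) && (b * y \in M).
  by rewrite memv_cap -memv_preim lfunE.
suff [NB | mN] : N = B \/ maximal_right_ideal B N.
- by move: xB; rewrite -NB NP => /andP[].
- by have := xM _ mN; rewrite NP => /andP[].
have [/eqP NB | NnB] := boolP (N == B); [by left | right].
split=> //.
  rewrite /right_ideal capvSl; apply/prodvP => u v; rewrite !NP.
  case/andP=> uB buM vB; apply/andP; split.
    by apply: BBs; apply: memv_mul.
  rewrite mulrA; exact: (subvP MB) (memv_mul buM vB).
move=> V /andP[VB VBV] NV.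
pose U := (M + amull b @: V)%VS.
have rU : right_ideal B U.
  apply/andP; split.
    rewrite subv_add MsB; apply/subvP => _ /memv_imgP[v vV ->].
    by rewrite lfunE /=; apply: BBs; apply: memv_mul => //; apply: (subvP VB).
  apply/prodvP => _ c /memv_addP[y yM [_ /memv_imgP[v vV ->]] ->] cB.
  rewrite lfunE /= mulrDl -mulrA; apply: memv_add.
    exact: (subvP MB) (memv_mul yM cB).
  apply/memv_imgP; exists (v * c); last by rewrite lfunE.
  exact: (subvP VBV) (memv_mul vV cB).
have [UM | UB] := Mmax U rU (addvSl _ _).
- left; apply/eqP; rewrite eqEsubv NV andbT; apply/subvP => v vV.
  rewrite NP; apply/andP; split; first exact: (subvP VB).
  rewrite -UM; apply: (subvP (addvSr _ _)).
  by apply/memv_imgP; exists v; rewrite ?lfunE.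
- right; apply/eqP; rewrite eqEsubv VB; apply/subvP => y yB.
  have : b * y \in U by rewrite UB; apply: BBs; apply: memv_mul.
  case/memv_addP => z zM [_ /memv_imgP[v vV ->]]; rewrite lfunE /= => byE.
  have : y - v \in N.
    rewrite NP; apply/andP; split; first by rewrite memvB // (subvP VB _ vV).
    by rewrite mulrBr byE addrK.
  by move/(subvP NV) => yvV; rewrite -(subrK v y) memvD.
Qed.

End Jacobson.

Section Idempotents.
Variables (K : fieldType) (R : falgType K).

Definition primitive_idempotent (e : R) : Prop :=
  [/\ e * e = e, e != 0 &
      forall f g : R, f * f = f -> g * g = g -> f * g = 0 -> g * f = 0 ->
        e = f + g -> f = 0 \/ g = 0].

Definition right_module_iso (U V : {vspace R}) : Prop :=
  exists f : R -> R,
    [/\ {in U &, {morph f : x y / x + y}},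
        {in U, forall x r, f (x * r) = f x * r},
        {in U, forall x, f x \in V},
        {in U &, injective f} &
        {in V, forall y, exists2 x, x \in U & f x = y}].

Variables (m : nat) (e : 'I_m -> R).

Definition complete_primitive_idempotents : Prop :=
  [/\ forall i, primitive_idempotent (e i),
      forall i j, i != j -> e i * e j = 0 &
      \sum_i e i = 1].

Definition basic : Prop := forall i j, i != j ->
  ~ right_module_iso (<[e i]> * {:R})%VS (<[e j]> * {:R})%VS.

Definition peirce (i j : 'I_m) : {vspace R} := (<[e i]> * {:R} * <[e j]>)%VS.

Definition corner (i : 'I_m) : {vspace R} := peirce i i.

(* J(Q_i) if i = j and A_ij otherwise. *)
Definition arrow_space (i j : 'I_m) : {vspace R} :=
  if i == j then jacobson (corner i) else peirce i j.

(* The space X_ij. *)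
Definition composite_space (i j : 'I_m) : {vspace R} :=
  if i == j then
    (jacobson (corner i) * jacobson (corner i)
     + \sum_(k | k != i) peirce i k * peirce k i)%VS
  else
    (jacobson (corner i) * peirce i j + peirce i j * jacobson (corner j)
     + \sum_(k | (k != i) && (k != j)) peirce i k * peirce k j)%VS.

(* The dimension of the quotient of [arrow_space i j] by its subspace
   [composite_space i j] (see [composite_space_sub] below). *)
Definition arrow_mult (i j : 'I_m) : nat :=
  (\dim (arrow_space i j) - \dim (composite_space i j))%N.

(* The classes of the elements x t of U form a basis of U / X. *)
Definition basis_modulo (U X : {vspace R}) d (x : 'I_d -> R) : Prop :=
  (forall t, x t \in U) /\
  (forall u, u \in U ->
     exists! c : {ffun 'I_d -> K}, u - \sum_t c t *: x t \in X).

End Idempotents.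

Section PeirceTheory.
Variables (K : fieldType) (R : falgType K) (m : nat) (e : 'I_m -> R).
Hypothesis he : complete_primitive_idempotents e.

Lemma idem_e i : e i * e i = e i.
Proof. by have [/(_ i) []] := he. Qed.

Lemma mem_eR i x : x \in (<[e i]> * {:R})%VS <-> e i * x = x.
Proof.
split=> [|<-]; last by rewrite memv_mul ?memv_line ?memvf.
suff /subvP s : (<[e i]> * {:R} <= lker (amull (e i) - \1%VF))%VS.
  by move=> /s; rewrite memv_ker !lfun_simp /= subr_eq0 => /eqP.
apply/prodvP => _ y /vlineP[k ->] _.
rewrite memv_ker !lfun_simp /= subr_eq0.
by rewrite mulrA -scalerAr idem_e.
Qed.

Lemma mem_peirce i j x : x \in peirce e i j <-> e i * x * e j = x.
Proof.
split=> [|<-]; last by rewrite !memv_mul ?memv_line ?memvf.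
suff /subvP s : (peirce e i j <= lker ((amulr (e j) \o amull (e i))%VF - \1%VF))%VS.
  by move=> /s; rewrite memv_ker !lfun_simp /= subr_eq0 => /eqP.
apply/prodvP => y _ /mem_eR yE /vlineP[k ->].
rewrite memv_ker !lfun_simp /= subr_eq0.
by rewrite mulrA yE -mulrA -scalerAl idem_e.
Qed.

Lemma peirce_id_l i j x : x \in peirce e i j -> e i * x = x.
Proof. by move/mem_peirce <-; rewrite !mulrA idem_e. Qed.

Lemma peirce_id_r i j x : x \in peirce e i j -> x * e j = x.
Proof. by move/mem_peirce <-; rewrite -!mulrA idem_e. Qed.

Lemma peirce_mul i j k x y :
  x \in peirce e i j -> y \in peirce e j k -> x * y \in peirce e i k.
Proof.
move=> xP yP; apply/mem_peirce.
by rewrite mulrA (peirce_id_l xP) -mulrA (peirce_id_r yP).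
Qed.

Lemma e_corner i : e i \in corner e i.
Proof. by apply/mem_peirce; rewrite !idem_e. Qed.

Lemma cornerM i x y :
  x \in corner e i -> y \in corner e i -> x * y \in corner e i.
Proof. exact: peirce_mul. Qed.

Lemma corner_mul i : (corner e i * corner e i <= corner e i)%VS.
Proof. by apply/prodvP => x y; apply: peirce_mul. Qed.

Lemma corner_idem i f : f \in corner e i -> f * f = f -> f = 0 \/ f = e i.
Proof.
move=> fC ff; have [/(_ i) [_ _ prim] _ _] := he.
have ef := peirce_id_l fC; have fe := peirce_id_r fC.
have h1 : f * (e i - f) = 0 by rewrite mulrBr fe ff subrr.
have h2 : (e i - f) * f = 0 by rewrite mulrBl ef ff subrr.
have h3 : (e i - f) * (e i - f) = e i - f.
  by rewrite mulrBr h2 subr0 mulrBl idem_e fe.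
have := prim f (e i - f) ff h3 h1 h2; rewrite addrC subrK.
case/(_ erefl) => [|/eqP]; first by left.
by rewrite subr_eq0 => /eqP ->; right.
Qed.

(* Fitting's lemma for the local algebra Q_i. *)
Lemma corner_fitting i y : y \in corner e i ->
  (exists n, y ^+ n.+1 = 0) \/ (exists2 w, w \in corner e i & y * w = e i).
Proof.
move=> yC; pose B := corner e i.
pose U n := (amull (y ^+ n.+1) @: B)%VS.
have yX n : y ^+ n.+1 \in B.
  by elim: n => [|n IH]; rewrite ?expr1 // exprS; apply: cornerM.
have UP n z : reflect (exists2 b, b \in B & z = y ^+ n.+1 * b) (z \in U n).
  by apply: (iffP memv_imgP) => [[b bB ->]|[b bB ->]]; exists b; rewrite ?lfunE.
have Umono p q : (U (p + q)%N <= U p)%VS.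
  apply/subvP => _ /UP[b bB ->]; apply/UP; case: q => [|q].
    by exists b; rewrite ?addn0.
  exists (y ^+ q.+1 * b); first exact: cornerM.
  by rewrite mulrA -exprD addSn.
have [n nmin] : exists n, forall k, (\dim (U n) <= \dim (U k))%N.
  pose E d := `[< exists n, \dim (U n) = d >].
  have E0 : exists d, E d by exists (\dim (U 0%N)); apply/asboolP; exists 0%N.
  case: (ex_minnP E0) => d /asboolP[n <-] dmin; exists n => k.
  by apply: dmin; apply/asboolP; exists k.
pose u := y ^+ n.+1.
have uB : u \in B := yX n.
have UU : U (n + n.+1)%N = U n by apply/eqP; rewrite eqEdim Umono nmin.
have stab z : z \in U n -> exists2 z', z' \in U n & z = u * z'.
  rewrite -{1}UU => /UP[b bB ->]; exists (u * b); first by apply/UP; exists b.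
  by rewrite mulrA -exprD addSn.
have inj z : z \in U n -> u * z = 0 -> z = 0.
  move=> zU uz; have : (amull u @: U n)%VS = U n.
    apply/eqP; rewrite eqEsubv; apply/andP; split; apply/subvP => t.
      case/memv_imgP => s /UP[b bB ->] ->; rewrite lfunE /=.
      by apply/UP; exists (u * b) => //; apply: cornerM.
    by case/stab => s sU ->; apply/memv_imgP; exists s; rewrite ?lfunE.
  move/(congr1 (fun V : {vspace R} => \dim V)) => dimE.
  have := limg_ker_dim (amull u) (U n); rewrite dimE.
  move/eqP; rewrite -{2}[\dim (U n)]add0n eqn_add2r dimv_eq0 => /eqP ker0.
  apply/eqP; rewrite -memv0 -ker0 memv_cap zU memv_ker lfunE /=.
  exact/eqP.
have uU : u \in U n.
  by apply/UP; exists (e i); rewrite ?(peirce_id_r uB) ?e_corner.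
have [w wU uw] := stab u uU.
have wB : w \in B by case/UP: wU => b bB ->; apply: cornerM.
have ww : w * w = w.
  apply/eqP; rewrite -subr_eq0; apply/eqP/inj.
    rewrite memvB //; case/UP: (wU) => b bB wE.
    by rewrite {1}wE -mulrA; apply/UP; exists (b * w); [apply: cornerM|].
  by rewrite mulrBr mulrA -uw -uw subrr.
have [w0 | we] := corner_idem wB ww.
  by left; exists n; rewrite -/u uw w0 mulr0.
right; case/UP: wU => b bB; rewrite we exprS -mulrA => wE.
exists (y ^+ n * b) => //; case: {+}n => [|k]; last exact: cornerM.
by rewrite mul1r.
Qed.

Hypothesis hb : basic e.

Lemma peirce_jacobson i k a b : k != i ->
  a \in peirce e i k -> b \in peirce e k i -> a * b \in jacobson (corner e i).
Proof.
move=> ki aP bP; apply/jacobsonP; split=> [|M]; first exact: peirce_mul bP.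
case=> /andP[MB MBM] MnB Mmax; apply: contrapT => abM.
pose B := corner e i.
have abB : a * b \in B by apply: peirce_mul bP.
pose U := (M + amull (a * b) @: B)%VS.
have rU : right_ideal B U.
  apply/andP; split.
    rewrite subv_add MB; apply/subvP => _ /memv_imgP[v vB ->].
    by rewrite lfunE /=; apply: peirce_mul vB.
  apply/prodvP => _ c /memv_addP[z zM [_ /memv_imgP[v vB ->]] ->] cB.
  rewrite lfunE /= mulrDl -mulrA; apply: memv_add.
    exact: (subvP MBM) (memv_mul zM cB).
  by apply/memv_imgP; exists (v * c); rewrite ?lfunE //; apply: peirce_mul cB.
have abU : a * b \in U.
  apply: (subvP (addvSr _ _)); apply/memv_imgP; exists (e i).
    exact: e_corner.
  by rewrite lfunE /= (peirce_id_r abB).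
have eM : e i \notin M.
  apply: contra MnB => eM; rewrite eqEsubv MB; apply/subvP => x xB.
  by rewrite -(peirce_id_l xB); apply: (subvP MBM); apply: memv_mul.
have [UM|UB] := Mmax U rU (addvSl _ _); first by rewrite -UM in abM.
have : e i \in U by rewrite UB e_corner.
case/memv_addP => z zM [_ /memv_imgP[c cB ->]]; rewrite lfunE /= => eE.
pose y := a * b * c; have yB : y \in B by apply: peirce_mul cB.
have zE : z = e i - y by rewrite eE addrK.
have [[n yn] | [w wB yw]] := corner_fitting yB.
  have geo p : exists2 s, s \in B & z * s = e i - y ^+ p.+1.
    elim: p => [|p [s sB zs]].
      by exists (e i); [exact: e_corner|
        rewrite zE mulrBl idem_e (peirce_id_r yB) expr1].
    have ypB : y ^+ p.+1 \in B.
      by elim: (p) => [|q IH]; rewrite ?expr1 // exprS; apply: cornerM.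
    exists (s + y ^+ p.+1); first by rewrite memvD.
    by rewrite mulrDr zs zE mulrBl (peirce_id_l ypB) -exprS addrA subrK.
  have [s sB zs] := geo n; case/negP: eM.
  by rewrite -[e i]subr0 -yn -zs; apply: (subvP MBM); apply: memv_mul.
pose d := b * (c * w).
have dP : d \in peirce e k i.
  by apply: peirce_mul bP _; apply: peirce_mul cB wB.
have ad : a * d = e i by rewrite /d -yw /y !mulrA.
have daC : d * a \in corner e k by apply: peirce_mul aP.
have dada : d * a * (d * a) = d * a.
  by rewrite mulrA -(mulrA d) ad (peirce_id_r dP).
have da : d * a = e k.
  have [da0 | //] := corner_idem daC dada.
  have [/(_ i) [_ /eqP ei0 _] _ _] := he; case: ei0.
  by rewrite -(idem_e i) -{1}ad -{1}ad mulrA -(mulrA a) da0 mulr0 mul0r.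
apply: (hb (i := i) (j := k)); first by rewrite eq_sym.
exists (fun x => d * x); split.
- by move=> x y' _ _; rewrite mulrDr.
- by move=> x _ r; rewrite mulrA.
- by move=> x _; apply/mem_eR; rewrite mulrA (peirce_id_l dP).
- move=> x x' /mem_eR xE /mem_eR x'E /= dx.
  by rewrite -xE -x'E -ad -(mulrA a d x) -(mulrA a d x') dx.
- move=> x /mem_eR xE; exists (a * x); last by rewrite mulrA da.
  by apply/mem_eR; rewrite mulrA (peirce_id_l aP).
Qed.

Lemma composite_space_sub i j : (composite_space e i j <= arrow_space e i j)%VS.
Proof.
rewrite /composite_space /arrow_space; case: eqP => [_|_]; rewrite !subv_add.
  apply/andP; split.
    apply/prodvP => x y xJ yJ; apply: jacobson_mulr (corner_mul i) xJ _.
    exact: (subvP (jacobson_sub _)) yJ.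
  apply/subv_sumP => k ki; apply/prodvP => x y; exact: peirce_jacobson.
apply/andP; split; last first.
  by apply/subv_sumP => k _; apply/prodvP => x y; apply: peirce_mul.
apply/andP; split; apply/prodvP => x y xP yP.
  exact: peirce_mul (subvP (jacobson_sub _) _ xP) yP.
exact: peirce_mul xP (subvP (jacobson_sub _) _ yP).
Qed.

End PeirceTheory.

Section BlockExtension.
Variables (K : fieldType) (R : falgType K) (m : nat) (e : 'I_m -> R).
Variable (n : 'I_m -> nat).

(* The space P_{ij,st}. *)
Definition block_entry (i : 'I_m) (j : 'I_(n i)) (s : 'I_m) (t : 'I_(n s)) :
    {vspace R} :=
  if i == s then if (j <= t)%N then corner e i else jacobson (corner e i)
  else peirce e i s.

Local Notation N := (\sum_i n i)%N.

(* [tagnat.sig1] and [tagnat.sig2] are the two components of the bijection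
   between 'I_(\sum_i n i) and the pairs (i, j) with j : 'I_(n i). *)
Definition block_mem (M : 'M[R]_N) : bool :=
  [forall k, forall l,
    M k l \in block_entry (tagnat.sig2 k) (tagnat.sig2 l)].

Lemma block_memP (M : 'M[R]_N) :
  reflect (forall k l, M k l \in block_entry (tagnat.sig2 k) (tagnat.sig2 l))
          (block_mem M).
Proof. by apply: (iffP 'forall_forallP). Qed.

End BlockExtension.

(* The hypotheses on e are parameters because the product of two matrices in
   [block_mem] is again in [block_mem] only when A_ik A_ki is contained in
   J(Q_i) for i != k. *)
Record block_ext (K : fieldType) (R : falgType K) (m : nat) (e : 'I_m -> R)
    (he : complete_primitive_idempotents e) (hb : basic e) (n : 'I_m -> nat) :=
  BlockExt {
    block_val : 'M[R]_(\sum_i n i);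
    _ : block_mem e block_val
  }.

Section BlockExtensionAlgebra.
Variables (K : fieldType) (R : falgType K) (m : nat) (e : 'I_m -> R).
Hypotheses (he : complete_primitive_idempotents e) (hb : basic e).
Variable (n : 'I_m -> nat).
Local Notation N := (\sum_i n i)%N.
Local Notation P := (block_ext he hb n).
Implicit Types A B C : P.

HB.instance Definition _ := [isSub for @block_val K R m e he hb n].
HB.instance Definition _ := [Choice of P by <:].

Lemma block_ext_inj A B : block_val A = block_val B -> A = B.
Proof. exact: val_inj. Qed.

Lemma block_valP A k l :
  block_val A k l \in block_entry e (tagnat.sig2 k) (tagnat.sig2 l).
Proof. by have /block_memP := valP A; apply. Qed.

Fact block_zmod_closed : zmod_closed (@block_mem K R m e n).
Proof.
split; first by apply/block_memP => k l; rewrite mxE mem0v.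
move=> A B /block_memP hA /block_memP hB; apply/block_memP => k l.
by rewrite !mxE memvB.
Qed.
HB.instance Definition _ := GRing.isZmodClosed.Build 'M[R]_N
  (@block_mem K R m e n) block_zmod_closed.
HB.instance Definition _ := [SubChoice_isSubZmodule of P by <:].

Lemma block_entry_sub i (j : 'I_(n i)) s (t : 'I_(n s)) :
  (block_entry e j t <= peirce e i s)%VS.
Proof.
rewrite /block_entry; case: eqP => [ij|_]; last exact: subvv.
have -> : peirce e i s = corner e i by rewrite /corner -ij.
by case: ifP => _; [exact: subvv | exact: jacobson_sub].
Qed.

Lemma block_entryM i (j : 'I_(n i)) s (t : 'I_(n s)) u (v : 'I_(n u)) x y :
  x \in block_entry e j v -> y \in block_entry e v t ->
  x * y \in block_entry e j t.
Proof.
move=> xP yP.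
have xQ := subvP (block_entry_sub _ _) _ xP.
have yQ := subvP (block_entry_sub _ _) _ yP.
have xyQ := peirce_mul he xQ yQ.
rewrite /block_entry; case: eqP => [ij|_] //; case: ifP => [_|tj].
  by move: xyQ; rewrite -ij.
case: s / ij t yP yQ xyQ tj => t yP yQ xyQ tj.
have [ui|ui] := eqVneq i u; last by apply: (peirce_jacobson he hb) yQ;
  rewrite // eq_sym.
case: u / ui v xP yP xQ yQ => v; rewrite /block_entry eqxx.
case: ifP => [jv|_] xP; case: ifP => [vt|_] yP xQ yQ.
- by rewrite (leq_trans jv vt) in tj.
- exact: jacobson_mull (corner_mul he i) xQ yP.
- exact: jacobson_mulr (corner_mul he i) xP yQ.
- exact: jacobson_mulr (corner_mul he i) xP yQ.
Qed.

Fact block_one_subproof :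
  block_mem e (\matrix_(k < N, l < N) (e (tagnat.sig1 k) *+ (k == l))).
Proof.
apply/block_memP => k l; rewrite mxE; case: eqP => [<-|_]; last exact: mem0v.
by rewrite /block_entry eqxx leqnn; apply: e_corner.
Qed.
Definition block_one : P := @BlockExt K R m e he hb n _ block_one_subproof.

Fact block_mul_subproof A B : block_mem e (block_val A *m block_val B).
Proof.
apply/block_memP => k l; rewrite mxE; apply: memv_suml => r _.
by apply: block_entryM; apply: block_valP.
Qed.
Definition block_mul A B : P :=
  @BlockExt K R m e he hb n _ (block_mul_subproof A B).

Fact block_scale_subproof (c : K) A : block_mem e (map_mx ( *:%R c) (block_val A)).
Proof.
by apply/block_memP => k l; rewrite mxE; apply: memvZ; apply: block_valP.
Qed.
Definition block_scale (c : K) A : P :=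
  @BlockExt K R m e he hb n _ (block_scale_subproof c A).

Lemma block_valD A B : block_val (A + B) = block_val A + block_val B.
Proof. by []. Qed.

Fact block_mulA : associative block_mul.
Proof. by move=> A B C; apply: block_ext_inj; rewrite /= mulmxA. Qed.
Fact block_mul1 : left_id block_one block_mul.
Proof.
move=> A; apply: block_ext_inj; apply/matrixP => k l; rewrite !mxE.
rewrite (bigD1 k) //= mxE eqxx mulr1n [X in _ + X]big1 ?addr0 => [|r rk].
  exact: (peirce_id_l he (subvP (block_entry_sub _ _) _ (block_valP A k l))).
by rewrite mxE eq_sym (negPf rk) mul0r.
Qed.
Fact block_mulr1 : right_id block_one block_mul.
Proof.
move=> A; apply: block_ext_inj; apply/matrixP => k l; rewrite !mxE.
rewrite (bigD1 l) //= mxE eqxx mulr1n [X in _ + X]big1 ?addr0 => [|r rk].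
  exact: (peirce_id_r he (subvP (block_entry_sub _ _) _ (block_valP A k l))).
by rewrite mxE (negPf rk) mulr0.
Qed.
Fact block_mulDl : left_distributive block_mul +%R.
Proof.
by move=> A B C; apply: block_ext_inj; rewrite block_valD /= -mulmxDl.
Qed.
Fact block_mulDr : right_distributive block_mul +%R.
Proof.
by move=> A B C; apply: block_ext_inj; rewrite block_valD /= -mulmxDr.
Qed.
HB.instance Definition _ := GRing.Zmodule_isPzRing.Build P
  block_mulA block_mul1 block_mulr1 block_mulDl block_mulDr.

Fact block_scaleA a b A :
  block_scale a (block_scale b A) = block_scale (a * b) A.
Proof.
by apply: block_ext_inj; apply/matrixP => k l; rewrite !mxE scalerA.
Qed.
Fact block_scale1 : left_id 1 block_scale.
Proof.
by move=> A; apply: block_ext_inj; apply/matrixP => k l; rewrite !mxE scale1r.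
Qed.
Fact block_scaleDr : right_distributive block_scale +%R.
Proof.
by move=> c A B; apply: block_ext_inj; apply/matrixP => k l;
  rewrite block_valD !mxE scalerDr.
Qed.
Fact block_scaleDl A : {morph block_scale^~ A : a b / a + b}.
Proof.
by move=> a b; apply: block_ext_inj; apply/matrixP => k l;
  rewrite block_valD !mxE scalerDl.
Qed.
HB.instance Definition _ := GRing.Zmodule_isLmodule.Build K P
  block_scaleA block_scale1 block_scaleDr block_scaleDl.

Lemma block_scalerAl (c : K) A B : c *: (A * B) = (c *: A) * B.
Proof.
apply: block_ext_inj; apply/matrixP => k l; rewrite !mxE scaler_sumr.
by apply: eq_bigr => r _; rewrite !mxE scalerAl.
Qed.
Lemma block_scalerAr (c : K) A B : c *: (A * B) = A * (c *: B).
Proof.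
apply: block_ext_inj; apply/matrixP => k l; rewrite !mxE scaler_sumr.
by apply: eq_bigr => r _; rewrite !mxE scalerAr.
Qed.

End BlockExtensionAlgebra.

Definition mult_quiver (m : nat) (d : 'I_m -> 'I_m -> nat) : quiver :=
  @Quiver 'I_m {p : 'I_m * 'I_m & 'I_(d p.1 p.2)}
    (fun a => (tag a).1) (fun a => (tag a).2).

Definition mult_arrow (m : nat) (d : 'I_m -> 'I_m -> nat) (i j : 'I_m)
    (t : 'I_(d i j)) : arrow (mult_quiver d) :=
  Tagged (fun p : 'I_m * 'I_m => 'I_(d p.1 p.2)) (i := (i, j)) t.

Section ExtensionQuiver.
Variables (m : nat) (d : 'I_m -> 'I_m -> nat) (n : 'I_m -> nat).
Hypothesis hn : forall i, (0 < n i)%N.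

Local Notation V := {i : 'I_m & 'I_(n i)}.

Definition ext_vertex i (j : 'I_(n i)) : V := Tagged (fun i => 'I_(n i)) j.

(* Positions are numbered from 0: the pairs (i, 1) and (i, n_i). *)
Definition first_vertex (i : 'I_m) : V := ext_vertex (Ordinal (hn i)).
Definition last_vertex (i : 'I_m) : V := ext_vertex (rev_ord (Ordinal (hn i))).

Fact delta_src_subproof k (j : 'I_k.-1) : (j < k)%N.
Proof. by case: k j => [|k] [j] //= /ltnW; rewrite ltnS. Qed.
Fact delta_tgt_subproof k (j : 'I_k.-1) : (j.+1 < k)%N.
Proof. by case: k j => [|k] [j]. Qed.

Local Notation arr := ({i : 'I_m & 'I_(n i).-1} + arrow (mult_quiver d))%type.

Definition ext_src (a : arr) : V :=
  match a with
  | inl c => ext_vertex (Ordinal (delta_src_subproof (tagged c)))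
  | inr b => last_vertex (src b)
  end.

Definition ext_tgt (a : arr) : V :=
  match a with
  | inl c => ext_vertex (Ordinal (delta_tgt_subproof (tagged c)))
  | inr b => first_vertex (tgt b)
  end.

Definition ext_quiver : quiver := @Quiver V arr ext_src ext_tgt.

Definition delta_arrow i (j : 'I_(n i).-1) : arrow ext_quiver :=
  inl (Tagged (fun i => 'I_(n i).-1) j).
Definition beta_arrow (a : arrow (mult_quiver d)) : arrow ext_quiver := inr a.

Variable K : fieldType.
Local Notation KQ := (path_alg K (mult_quiver d)).
Local Notation KQ' := (path_alg K ext_quiver).

Definition delta (i : 'I_m) : KQ' :=
  triv_elt K (first_vertex i : vertex ext_quiver) *
  \prod_(j < (n i).-1) arrow_elt K (delta_arrow j).

(* The value on trivial paths is irrelevant: the extension map is only used on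
   the span of the paths of positive length. *)
Definition ext_path (p : qpath (mult_quiver d)) : KQ' :=
  if parrows p is a :: s then
    arrow_elt K (beta_arrow a) *
    \prod_(b <- s) (delta (src b) * arrow_elt K (beta_arrow b))
  else 0.

Definition ext_map : KQ -> KQ' := lin_ext ext_path.
HB.instance Definition _ := GRing.Linear.on ext_map.

End ExtensionQuiver.

(* Main.v *)
Require Import Defs.
From HB Require Import structures.
From mathcomp Require Import all_boot all_order all_algebra all_field.
From mathcomp Require Import boolp finmap monalg zify.

Set Implicit Arguments.
Unset Strict Implicit.
Unset Printing Implicit Defensive.

Import GRing.Theory.

Local Open Scope ring_scope.

(** Deleting the arrows delta from a path of Q' from (i, j) to (s, t) leaves a
    path of Q from i to s.  The path of Q' can be recovered from its end points
    and from what is left, because between two consecutive arrows of Q it must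
    run through a whole chain delta_i.  Every path of Q from i to s is obtained
    in this way, with one exception: the trivial path at i comes from a piece of
    the chain from (i, j) to (i, t), which exists only if j <= t.  So the part
    of KQ' between (i, j) and (s, t) is a copy of the span of the paths of Q
    from i to s, without the trivial one when i = s and j > t.  In other words,
    KQ' is itself the block extension of KQ, the span of the paths of positive
    length taking the place of the radical.

    The deletion of the deltas is [collapse_map], and its inverse at a given
    pair of vertices k, l of Q' is [ext_lift k l]; that they are inverse to each
    other is the content of [sum_lift_collapse] and [collapse_lift].  Applying
    phi to each entry gives an algebra homomorphism [block_map] from KQ' to P,
    and the theorem is that it is surjective with kernel generated by the
    elements e(rho).

    For the surjectivity, an entry M k l of a matrix of P is the image under phi
    of some b in KQ, and b has to be without trivial paths when l precedes k or
    lies over another vertex of Q.  This is automatic: phi sends a cycle of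
    positive length at i into J(Q_i), which does not contain e_i, so the
    coefficient in b of the trivial path at i can be read off from
    e_i phi(b) e_i modulo J(Q_i) ([coef_triv_eq0]).  The same remark shows that
    no trivial path appears in an element of Ker phi.

    For the kernel, an element x of KQ' killed by [block_map] is the sum of the
    lifts of its entries in KQ, and these entries lie in Ker phi. Hence it is
    enough that every lift of an element of Ker phi belongs to the ideal
    generated by the e(rho). The elements of Ker phi all of whose lifts have
    this property form an ideal of KQ, by the rules [ext_lift_arrow_mul] and
    [ext_lift_mul_arrow] for the lift of a product with an arrow; and this ideal
    contains each rho, because up to a piece of chain on either side the lift of
    rho is e(rho) ([ext_lift_ext_map]). So it is all of Ker phi. *)

(** * Paths and their products *)

Section PathAlgebraRules.
Variables (K : fieldType) (Q : quiver).
Local Notation A := (path_alg K Q).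
Implicit Types (a : A) (p q r : qpath Q) (v : vertex Q) (x : arrow Q).

Lemma path_ext p q : psrc p = psrc q -> parrows p = parrows q -> p = q.
Proof.
move=> e1 e2; apply: val_inj; rewrite /= [LHS]surjective_pairing.
by rewrite [RHS]surjective_pairing; congr pair.
Qed.

Lemma path_mulE p q : pa_path K p * pa_path K q = path_mul K p q.
Proof. exact: pa_mulUU. Qed.

Lemma path_mul_concat p q r :
  ptgt p = psrc q -> psrc r = psrc p -> parrows r = parrows p ++ parrows q ->
  pa_path K p * pa_path K q = pa_path K r.
Proof.
move=> pq rs ra; rewrite path_mulE /path_mul.
suff -> : concat_path p q = Some r by [].
apply/concat_pathP; split=> //.
by rewrite [LHS]surjective_pairing; congr pair.
Qed.

Lemma path_mul_disconnected p q :
  ptgt p <> psrc q -> pa_path K p * pa_path K q = 0.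
Proof.
by move=> pq; rewrite path_mulE /path_mul (concat_path_eq_None _ _).2.
Qed.

Lemma triv_mul_path v p :
  triv_elt K v * pa_path K p = if psrc p == v then pa_path K p else 0.
Proof. by rewrite path_mulE /path_mul concat_triv_path; case: ifP. Qed.

Lemma path_mul_triv v p :
  pa_path K p * triv_elt K v = if ptgt p == v then pa_path K p else 0.
Proof. by rewrite path_mulE /path_mul concat_path_triv; case: ifP. Qed.

Lemma triv_mul_arrow v x :
  triv_elt K v * arrow_elt K x = if src x == v then arrow_elt K x else 0.
Proof. exact: triv_mul_path. Qed.

Lemma arrow_mul_triv v x :
  arrow_elt K x * triv_elt K v = if tgt x == v then arrow_elt K x else 0.
Proof. exact: path_mul_triv. Qed.

Lemma triv_mul_triv v w :
  triv_elt K v * triv_elt K w = if v == w then triv_elt K w else 0.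
Proof. by rewrite triv_mul_path eq_sym. Qed.

Lemma sum_triv : \sum_v triv_elt K v = 1 :> A.
Proof. by rewrite -[1]/(pa_one K Q) pa_one.unlock. Qed.

Lemma path_nil p : parrows p = [::] -> p = triv_path (psrc p).
Proof. by move=> p0; apply: path_ext. Qed.

Lemma path_uncons p x s : parrows p = x :: s ->
  exists q, [/\ psrc p = src x, psrc q = tgt x, parrows q = s, ptgt q = ptgt p &
                pa_path K p = arrow_elt K x * pa_path K q].
Proof.
move=> pE; have := valP p; rewrite -/(psrc p) -/(parrows p) pE /=.
case/andP => /eqP sx xs; exists (@QPath Q (tgt x, s) xs); split=> //.
- by rewrite /ptgt /pend pE.
- by symmetry; apply: path_mul_concat; rewrite ?pE //=.
Qed.

Lemma path_cons x q : psrc q = tgt x ->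
  exists p, [/\ psrc p = src x, parrows p = x :: parrows q, ptgt p = ptgt q &
                arrow_elt K x * pa_path K q = pa_path K p].
Proof.
move=> qx; have xq : is_path (src x) (x :: parrows q).
  by rewrite /= eqxx -qx; exact: valP q.
exists (@QPath Q (src x, x :: parrows q) xq); split=> //.
  by rewrite /ptgt /pend qx.
by apply: path_mul_concat.
Qed.

Lemma path_rcons q x : ptgt q = src x ->
  exists p, [/\ psrc p = psrc q, parrows p = rcons (parrows q) x,
                ptgt p = tgt x & pa_path K q * arrow_elt K x = pa_path K p].
Proof.
move=> qx; have xq : is_path (psrc q) (rcons (parrows q) x).
  rewrite -cats1 is_path_cat (valP q) /= andbT -qx; exact/eqP.
exists (@QPath Q (psrc q, rcons (parrows q) x) xq); split=> //.
  by rewrite /ptgt /pend /= map_rcons last_rcons.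
by apply: path_mul_concat => //; exact: esym (cats1 _ _).
Qed.

Lemma path_alg_ind (P : A -> Prop) : P 0 ->
  (forall c a b, P a -> P b -> P (c *: a + b)) ->
  (forall p, P (pa_path K p)) -> forall a, P a.
Proof.
move=> P0 PD Pp a; rewrite (pa_sumE a); elim: (enum_fset _) => [|p s IH].
  by rewrite big_nil.
by rewrite big_cons; apply: PD.
Qed.

(** The trivial paths and the arrows generate the path algebra: this form of
    induction reduces the stability of a subspace under left multiplication to
    these two cases. *)
Lemma path_gen_ind (P : A -> Prop) : P 0 ->
  (forall c a b, P a -> P b -> P (c *: a + b)) ->
  (forall v, P (triv_elt K v)) ->
  (forall x a, P a -> P (arrow_elt K x * a)) -> forall a, P a.
Proof.
move=> P0 PD Pv Px; apply: path_alg_ind => // p.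
move En: (parrows p) => s; elim: s p En => [|x s IH] p En.
  by rewrite (path_nil En); apply: Pv.
by have [q [_ _ qs _ ->]] := path_uncons En; apply/Px/IH.
Qed.

Lemma supp_triv a p : p \in msupp a -> parrows p = [::] ->
  a@_(triv_path (psrc p)) != 0.
Proof. by move=> pa /path_nil <-; rewrite mcoeff_neq0. Qed.

End PathAlgebraRules.

(** * Chains of deltas *)

Section Extension.
Variables (K : fieldType) (m : nat) (d : 'I_m -> 'I_m -> nat) (n : 'I_m -> nat).
Hypothesis hn : forall i, (0 < n i)%N.

Local Notation Q := (mult_quiver d).
Local Notation Q' := (ext_quiver d hn).
Local Notation V := {i : 'I_m & 'I_(n i)}.
Local Notation first := (first_vertex hn).
Local Notation last := (last_vertex hn).
Local Notation triv := (triv_elt K).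
Local Notation arr := (arrow_elt K).
Local Notation beta a := (arr (beta_arrow hn a)).
Implicit Types (k l : V) (a : arrow Q) (i : 'I_m).

Definition reaches k l : bool :=
  (tag k == tag l) && (tagged k <= tagged l)%N.

(** The arrow delta leaving (i, u), indexed by a natural number so that the
    pieces of the chain at i can be written as products over intervals. *)
Definition delta_step i (u : nat) : path_alg K Q' :=
  if (insub u : option 'I_(n i).-1) is Some o then
    arr (delta_arrow d hn o) else 0.

(** The value 0 stands for the missing path: products through k and l then
    vanish when no chain of deltas connects these vertices. *)
Definition segment k l : path_alg K Q' :=
  if reaches k l then
    triv (k : vertex Q') * \prod_(tagged k <= u < tagged l) delta_step (tag k) u
  else 0.

Lemma reaches_refl k : reaches k k.
Proof. by rewrite /reaches eqxx leqnn. Qed.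

Lemma first_reaches i l : tag l = i -> reaches (first i) l.
Proof. by move=> li; rewrite /reaches /= leq0n andbT; apply/eqP. Qed.

Lemma reaches_last i k : tag k = i -> reaches k (last i).
Proof.
by move=> <-; rewrite /reaches /= eqxx /= subn1 -ltnS prednK.
Qed.

Lemma vertex_eq k l : tag k = tag l -> tagged k = tagged l :> nat -> k = l.
Proof.
case: k l => [i j] [i' j'] /= e; case: i' / e j' => j' /= jj.
by congr existT; apply: val_inj.
Qed.

Lemma first_inj : injective (first : 'I_m -> V).
Proof. by move=> i j /(congr1 (@tag _ _)). Qed.

Lemma last_inj : injective (last : 'I_m -> V).
Proof. by move=> i j /(congr1 (@tag _ _)). Qed.

Lemma segment_refl k : segment k k = triv (k : vertex Q').
Proof. by rewrite /segment reaches_refl big_geq // mulr1. Qed.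

Lemma segment_step (c : {i : 'I_m & 'I_(n i).-1}) l :
  reaches (ext_tgt hn (inl c : arrow Q')) l ->
  segment (ext_src hn (inl c : arrow Q')) l =
  arr (inl c : arrow Q') * segment (ext_tgt hn (inl c : arrow Q')) l.
Proof.
case: c => i c kl; rewrite /segment kl; move: kl.
rewrite {1 2}/reaches /= => /andP[-> cl]; rewrite (ltnW cl) /= big_ltn //.
rewrite !mulrA [in RHS]arrow_mul_triv eqxx; congr (_ * _).
by rewrite /delta_step valK triv_mul_arrow eqxx.
Qed.

(** Induction along the piece of chain from k to l, on the side of its source:
    this is where the position of k has to be turned into an arrow of Q'. *)
Lemma segment_ind l (P : V -> path_alg K Q' -> Prop) :
  P l (triv (l : vertex Q')) ->
  (forall c : {i : 'I_m & 'I_(n i).-1},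
     let a := inl c : arrow Q' in
     reaches (ext_tgt hn a) l ->
     P (ext_tgt hn a) (segment (ext_tgt hn a) l) ->
     P (ext_src hn a) (arr a * segment (ext_tgt hn a) l)) ->
  forall k, reaches k l -> P k (segment k l).
Proof.
move=> Pl Ps k kl; move Eu: (tagged l - tagged k)%N => u.
elim: u k kl Eu => [|u IH] k /andP[/eqP ti kl] Eu.
  have -> : k = l by apply: vertex_eq => //; lia.
  by rewrite segment_refl.
have kl' : (tagged k < tagged l)%N by lia.
have hk : (tagged k < (n (tag k)).-1)%N.
  have tl : (tagged l < n (tag k))%N by rewrite ti; exact: ltn_ord.
  by lia.
pose c : {i : 'I_m & 'I_(n i).-1} := Tagged _ (Ordinal hk).
have -> : k = ext_src hn (inl c : arrow Q') by apply: vertex_eq.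
have rc : reaches (ext_tgt hn (inl c : arrow Q')) l.
  by rewrite /reaches /= kl' andbT; apply/eqP.
by rewrite segment_step //; apply: Ps => //; apply: IH => //=; lia.
Qed.

Lemma triv_segment k l : triv (k : vertex Q') * segment k l = segment k l.
Proof.
by rewrite /segment; case: ifP => _; rewrite ?mulr0 // mulrA triv_mul_triv eqxx.
Qed.

Lemma segment_triv k l : segment k l * triv (l : vertex Q') = segment k l.
Proof.
have [kl|/negPf nkl] := boolP (reaches k l); last by rewrite /segment nkl mul0r.
apply: (segment_ind (P := fun _ s => s * _ = s)) kl.
  by rewrite triv_mul_triv eqxx.
by move=> c a _ IH; rewrite -mulrA IH.
Qed.

Lemma segment0 k l : tag k <> tag l -> segment k l = 0.
Proof. by move=> /eqP/negPf kl; rewrite /segment /reaches kl. Qed.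

Lemma delta_segment i : delta d hn K i = segment (first i) (last i).
Proof.
rewrite /segment first_reaches // /delta; congr (_ * _).
rewrite /= subn1 big_mkord; apply: eq_bigr => o _.
by rewrite /delta_step valK.
Qed.

(** * Lifting paths of Q to paths of Q' *)

(** The path of Q' from k to l whose arrows of Q are those of s: chains of
    deltas fill the gaps between them and connect them to k and l. *)
Fixpoint lift_word k l (s : seq (arrow Q)) : path_alg K Q' :=
  if s is a :: s' then
    segment k (last (src a)) * beta a * lift_word (first (tgt a)) l s'
  else segment k l.

(** The lift of a path of Q that does not start below k, or does not end below
    l, is 0: thus [ext_lift k l] only sees the part of KQ between the images of
    k and l.  It is not multiplicative, as a trivial path may have no lift. *)
Definition ext_lift k l : path_alg K Q -> path_alg K Q' :=
  lin_ext (fun q : qpath Q =>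
    if psrc q == tag k then lift_word k l (parrows q) else 0).
HB.instance Definition _ k l := GRing.Linear.on (ext_lift k l).

Lemma ext_lift_path k l (q : qpath Q) :
  ext_lift k l (pa_path K q) =
  if psrc q == tag k then lift_word k l (parrows q) else 0.
Proof. exact: lin_ext_path. Qed.

Lemma ext_lift_src k l b :
  triv (k : vertex Q') * ext_lift k l b = ext_lift k l b.
Proof.
move: b; apply: path_alg_ind => [|c a b ea eb|q].
- by rewrite linear0 mulr0.
- by rewrite linearP /= mulrDr -pa_scalerAr ea eb.
rewrite ext_lift_path; case: ifP => _; last by rewrite mulr0.
by case: (parrows q) => [|a s] /=; rewrite ?mulrA triv_segment.
Qed.

Lemma ext_lift_tgt k l b :
  ext_lift k l b * triv (l : vertex Q') = ext_lift k l b.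
Proof.
move: b; apply: path_alg_ind => [|c a b ea eb|q].
- by rewrite linear0 mul0r.
- by rewrite linearP /= mulrDl -pa_scalerAl ea eb.
rewrite ext_lift_path; case: ifP => _; last by rewrite mul0r.
elim: (parrows q) k => [|a s IH] k /=; first exact: segment_triv.
by rewrite -mulrA IH.
Qed.

(** The last chain of a lifted word starts where the word ends, so it cannot
    reach a vertex l lying over another vertex of Q. *)
Lemma lift_word0 k l s (v : 'I_m) : is_path (v : vertex Q) s -> v = tag k ->
  pend (v : vertex Q) s <> tag l -> lift_word k l s = 0.
Proof.
elim: s k v => [|a s IH] k v /=; first by move=> _ -> kl; apply: segment0.
by case/andP=> _ st _ sl; rewrite (IH (first (tgt a)) (tgt a)) ?mulr0.
Qed.

Lemma ext_lift_mul_triv_l k l (v : vertex Q) b :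
  ext_lift k l (triv v * b) = if v == tag k then ext_lift k l b else 0.
Proof.
move: b; apply: path_alg_ind => [|c a b ea eb|q].
- by rewrite mulr0 !linear0; case: ifP.
- rewrite mulrDr -pa_scalerAr !linearP /= ea eb.
  by case: ifP => // _; rewrite scaler0 addr0.
rewrite triv_mul_path; have [<-|qv] := eqVneq (psrc q) v.
  by rewrite ext_lift_path; case: ifP.
by rewrite linear0 ext_lift_path; case: eqP => // <-; rewrite (negPf qv).
Qed.

Lemma ext_lift_mul_triv_r k l (v : vertex Q) b :
  ext_lift k l (b * triv v) = if v == tag l then ext_lift k l b else 0.
Proof.
move: b; apply: path_alg_ind => [|c a b ea eb|q].
- by rewrite mul0r !linear0; case: ifP.
- rewrite mulrDl -pa_scalerAl !linearP /= ea eb.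
  by case: ifP => // _; rewrite scaler0 addr0.
have q0 : ptgt q <> tag l -> ext_lift k l (pa_path K q) = 0.
  rewrite ext_lift_path; case: eqP => // qk ql.
  by apply: (@lift_word0 _ _ _ (psrc q)) => //; exact: valP q.
rewrite path_mul_triv; have [<-|qv] := eqVneq (ptgt q) v.
  by case: eqP => // ql; rewrite q0.
by rewrite linear0; case: eqP => // vl; rewrite q0 // -vl; apply/eqP.
Qed.

(** Past the arrow a every lift starts at the beginning of a chain, so this
    rule holds for all b, trivial paths included: the chain from there to any l
    over the same vertex exists.  It replaces the failing multiplicativity of
    the lift. *)
Lemma ext_lift_arrow_mul k l a b :
  ext_lift k l (arr a * b) =
  segment k (last (src a)) * beta a * ext_lift (first (tgt a)) l b.
Proof.
move: b; apply: path_alg_ind => [|c b b' eb eb'|q].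
- by rewrite mulr0 !linear0 mulr0.
- by rewrite mulrDr -pa_scalerAr !linearP /= eb eb' mulrDr -pa_scalerAr.
have [qa|qa] := eqVneq (psrc q) (tgt a).
  have [p [ps pr _ ->]] := path_cons K qa.
  rewrite !ext_lift_path ps pr /= qa eqxx; case: eqP => // ak.
  by rewrite segment0 ?mul0r //= => e; case: ak.
rewrite ext_lift_path /= (negPf qa) mulr0 path_mul_disconnected ?linear0 //.
by move/esym; apply/eqP.
Qed.

Lemma lift_word_rcons k l s a :
  lift_word k l (rcons s a) =
  lift_word k (last (src a)) s * beta a * segment (first (tgt a)) l.
Proof. by elim: s k => [|b s IH] k //=; rewrite IH !mulrA. Qed.

Lemma ext_lift_mul_arrow k l a b :
  ext_lift k l (b * arr a) =
  ext_lift k (last (src a)) b * beta a * segment (first (tgt a)) l.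
Proof.
move: b; apply: path_alg_ind => [|c b b' eb eb'|q].
- by rewrite mul0r !linear0 !mul0r.
- by rewrite mulrDl -pa_scalerAl !linearP /= eb eb' !mulrDl -!pa_scalerAl.
have [qa|qa] := eqVneq (ptgt q) (src a).
  have [p [ps pr _ ->]] := path_rcons K qa.
  rewrite !ext_lift_path ps pr lift_word_rcons.
  by case: ifP => // _; rewrite !mul0r.
rewrite path_mul_disconnected ?linear0; last by apply/eqP.
rewrite ext_lift_path; case: eqP => [qk|_]; last by rewrite !mul0r.
by rewrite (lift_word0 (valP q)) ?mul0r //; apply/eqP.
Qed.

(** * Deleting the deltas *)

Definition collapse_word (s : seq (arrow Q')) : seq (arrow Q) :=
  pmap (fun x => if x is inr a then Some a else None) s.

Lemma collapse_path_subproof (k : vertex Q') s : is_path k s ->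
  is_path (tag (k : V) : vertex Q) (collapse_word s) /\
  pend (tag (k : V) : vertex Q) (collapse_word s) = tag (pend k s : V).
Proof.
by elim: s k => [|[c|a] s IH] k //= /andP[/eqP <- /IH[]] //=; rewrite eqxx.
Qed.

Definition collapse (p : qpath Q') : qpath Q :=
  @QPath Q (tag (psrc p : V), collapse_word (parrows p))
    (collapse_path_subproof (valP p)).1.

Lemma ptgt_collapse p : ptgt (collapse p) = tag (ptgt p : V).
Proof. exact: (collapse_path_subproof (valP p)).2. Qed.

Definition collapse_map : path_alg K Q' -> path_alg K Q :=
  lin_ext (fun p => pa_path K (collapse p)).
HB.instance Definition _ := GRing.Linear.on collapse_map.

Lemma collapse_map_path p : collapse_map (pa_path K p) = pa_path K (collapse p).
Proof. exact: lin_ext_path. Qed.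

(** Deleting the deltas is compatible with concatenation, but paths of Q' that
    do not compose may do so afterwards; hence the vertex in the middle. *)
Lemma collapse_mapM r x y :
  collapse_map (x * triv r * y) =
  collapse_map (x * triv r) * collapse_map (triv r * y).
Proof.
move: x; apply: path_alg_ind => [|c a b ea eb|p].
- by rewrite !(mul0r, linear0).
- by rewrite !(mulrDl, linearP, =^~ pa_scalerAl) /= ea eb.
rewrite path_mul_triv; have [pr|pr] := eqVneq (ptgt p) r; last first.
  by rewrite !(mul0r, linear0).
move: y; apply: path_alg_ind => [|c a b ea eb|q].
- by rewrite !(mulr0, linear0).
- by rewrite !(mulrDr, linearP, =^~ pa_scalerAr) /= ea eb.
rewrite triv_mul_path; have [qr|qr] := eqVneq (psrc q) r; last first.
  rewrite linear0 mulr0 path_mul_disconnected ?linear0 //.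
  by rewrite pr => e; rewrite -e eqxx in qr.
have pq : ptgt p = psrc q by rewrite pr qr.
pose pq' := @QPath Q' (psrc p, parrows p ++ parrows q)
  (concat_path_subproof pq).
rewrite (@path_mul_concat _ _ p q pq') // !collapse_map_path.
apply/esym/path_mul_concat => //.
  by rewrite ptgt_collapse pq.
by rewrite /parrows /= /collapse_word pmap_cat.
Qed.

Lemma collapse_map_triv (k : vertex Q') :
  collapse_map (triv k) = triv (tag (k : V) : vertex Q).
Proof.
rewrite collapse_map_path; congr pa_path; exact: path_ext.
Qed.

Lemma collapse_map_beta a : collapse_map (beta a) = arr a.
Proof. by rewrite collapse_map_path; congr pa_path; apply: path_ext. Qed.

Lemma collapse_map_delta (c : {i : 'I_m & 'I_(n i).-1}) :
  collapse_map (arr (inl c : arrow Q')) = triv (tag c : vertex Q).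
Proof. by rewrite collapse_map_path; congr pa_path; apply: path_ext. Qed.

Lemma collapse_mapM_triv r x y : x * triv r = x -> triv r * y = y ->
  collapse_map (x * y) = collapse_map x * collapse_map y.
Proof. by move=> ex ey; rewrite -{1}ex collapse_mapM ex ey. Qed.

Lemma collapse_segment k l : reaches k l ->
  collapse_map (segment k l) = triv (tag l : vertex Q).
Proof.
move=> kl.
pose P k s := collapse_map s = triv (tag l : vertex Q) /\ tag k = tag l.
suff [] : P k (segment k l) by [].
apply: segment_ind kl => [|c a ra [IH ti]].
  by split=> //; exact: collapse_map_triv.
split=> //; rewrite (@collapse_mapM_triv (ext_tgt hn a)) ?triv_segment //.
  rewrite collapse_map_delta IH triv_mul_triv ifT //.
  by apply/eqP.
by rewrite arrow_mul_triv eqxx.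
Qed.

(** Deleting the deltas is left inverse to lifting, except on a trivial path
    that cannot be lifted because l precedes k. *)
Lemma collapse_lift_path k l q :
  parrows q != [::] \/ reaches k l ->
  collapse_map (ext_lift k l (pa_path K q)) =
  triv (tag k : vertex Q) * pa_path K q * triv (tag l : vertex Q).
Proof.
rewrite triv_mul_path ext_lift_path.
have [qk|_] := eqVneq (psrc q) (tag k); last first.
  by rewrite mul0r linear0.
rewrite path_mul_triv.
move Es: (parrows q) => s; elim: s q k qk Es => [|a s IH] q k qk Es.
  case=> // kl; rewrite collapse_segment // (path_nil Es) /= qk ifT.
    by case/andP: kl => /eqP e _; rewrite e.
  by case/andP: kl.
move=> _; have [p [qs ps pa pt ->]] := path_uncons K Es => /=.
have sk : reaches k (last (src a)) by apply: reaches_last; rewrite -qk.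
have E : collapse_map (segment k (last (src a)) * beta a) = arr a.
  rewrite (@collapse_mapM_triv (last (src a))) ?segment_triv //; last first.
    by rewrite triv_mul_arrow eqxx.
  by rewrite collapse_segment // collapse_map_beta triv_mul_arrow eqxx.
case: s => [|b s] in IH pa Es *.
  have -> : pa_path K p = triv (tgt a) by rewrite (path_nil pa) ps.
  rewrite arrow_mul_triv eqxx /=; have [al|al] := eqVneq (ptgt q) (tag l).
    rewrite (@collapse_mapM_triv (first (tgt a))) ?triv_segment //; last first.
      by rewrite -mulrA arrow_mul_triv eqxx.
    rewrite E collapse_segment; last first.
      by rewrite first_reaches // -al -pt /ptgt ps pa.
    by rewrite -al -pt /ptgt ps pa arrow_mul_triv eqxx.
  rewrite (@segment0 (first (tgt a)) l) ?mulr0 ?linear0 // => e.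
  by move/eqP: al; rewrite -e -pt /ptgt ps pa.
have := IH p (first (tgt a)) ps pa (or_introl isT); rewrite pt => IH'.
rewrite (@collapse_mapM_triv (first (tgt a))) //; last first.
- by rewrite /= !mulrA triv_segment.
- by rewrite -mulrA arrow_mul_triv eqxx.
by rewrite E IH'; case: ifP => // _; rewrite mulr0.
Qed.

Lemma collapse_lift k l b :
  (forall i : vertex Q, b@_(triv_path i) = 0) \/ reaches k l ->
  collapse_map (ext_lift k l b) =
  triv (tag k : vertex Q) * b * triv (tag l : vertex Q).
Proof.
move=> h; rewrite {1 2}(pa_sumE b) !linear_sum mulr_sumr mulr_suml.
apply: eq_big_seq => p pb; rewrite !linearZ /= -pa_scalerAr -pa_scalerAl.
congr (_ *: _); apply: collapse_lift_path; case: h => [h|]; [left|by right].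
by apply/eqP => p0; have := supp_triv pb p0; rewrite h eqxx.
Qed.

(** Deltas only move forward along a chain. *)
Lemma reaches_delta_path (k : vertex Q') s : is_path k s ->
  collapse_word s = [::] -> reaches k (pend k s).
Proof.
elim: s k => [|[c|a] s IH] k //=; first by rewrite reaches_refl.
case/andP=> /eqP <- /IH{}IH /IH{IH}.
rewrite /pend /=.
rewrite -[seq.last _ _]/(pend (ext_tgt hn (inl c : arrow Q') : vertex Q') s).
by case/andP => /= ti /ltnW lt; rewrite /reaches /= ti.
Qed.

(** A path of Q' is determined by its end points and its arrows of Q. *)
Lemma lift_collapse_path (p : qpath Q') :
  ext_lift (psrc p : V) (ptgt p : V) (pa_path K (collapse p)) = pa_path K p.
Proof.
rewrite ext_lift_path eqxx -[parrows (collapse p)]/(collapse_word (parrows p)).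
move Es: (parrows p) => s; elim: s p Es => [|[c|a] s IH] p Es.
- have e : ptgt p = psrc p by rewrite /ptgt Es.
  by rewrite /= e segment_refl [in RHS](path_nil Es).
- have [q [-> qs qa <- ->]] := path_uncons K Es; rewrite -(IH q qa) qs.
  rewrite /=; case Ew: (collapse_word s) => [|a t] /=.
    have : reaches (psrc q : V) (ptgt q : V).
      by apply: reaches_delta_path; [exact: valP q | rewrite -/(parrows q) qa].
    by rewrite qs; exact: segment_step.
  rewrite (segment_step (c := c)) ?mulrA //; apply: reaches_last.
  have := valP (collapse q); rewrite /= qa Ew /= => /andP[/eqP -> _].
  by rewrite qs.
- have [q [-> qs qa <- ->]] := path_uncons K Es; rewrite -(IH q qa) qs /=.
  by rewrite segment_refl triv_mul_arrow eqxx.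
Qed.

Lemma sum_lift_collapse x :
  \sum_(k : V) \sum_(l : V)
    ext_lift k l
      (collapse_map (triv (k : vertex Q') * x * triv (l : vertex Q'))) = x.
Proof.
move: x; apply: path_alg_ind => [|c x y ex ey|p].
- rewrite big1 // => k _; rewrite big1 // => l _.
  by rewrite mulr0 mul0r !linear0.
- rewrite -{2}ex -{2}ey scaler_sumr -big_split; apply: eq_bigr => k _ /=.
  rewrite scaler_sumr -big_split; apply: eq_bigr => l _ /=.
  by rewrite mulrDr mulrDl -!(pa_scalerAr, pa_scalerAl) !linearP /= ?linearP.
rewrite (bigD1 (psrc p : V)) //= [X in _ + X]big1 ?addr0 => [|k kp]; last first.
  rewrite big1 // => l _.
  by rewrite triv_mul_path eq_sym (negPf kp) mul0r !linear0.
rewrite (bigD1 (ptgt p : V)) //= [X in _ + X]big1 ?addr0 => [|l lp]; last first.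
  by rewrite triv_mul_path eqxx path_mul_triv eq_sym (negPf lp) !linear0.
rewrite triv_mul_path eqxx path_mul_triv eqxx collapse_map_path.
exact: lift_collapse_path.
Qed.

(** * Comparison with the extension map *)

Lemma ext_map_path (q : qpath Q) : ext_map hn (pa_path K q) = ext_path hn K q.
Proof. exact: lin_ext_path. Qed.

(** The lift of a word and its image under the extension map run through the
    same full chains between the arrows of Q; they differ in the last piece,
    which leads to l in the first case and is missing in the second. *)
Lemma lift_word_ext_word a s l : is_path (tgt a) s ->
  beta a * lift_word (first (tgt a)) l s =
  beta a * \prod_(b <- s) (delta d hn K (src b) * beta b) *
    segment (first (tag l)) l.
Proof.
elim: s a => [|b s IH] a; last first.
  case/andP => /eqP ba bs; rewrite big_cons delta_segment ba.
  have -> : lift_word (first (tgt a)) l (b :: s) =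
      segment (first (tgt a)) (last (src b)) * beta b *
      lift_word (first (tgt b)) l s.
    by [].
  by rewrite -!mulrA IH // ba -!mulrA.
move=> _; rewrite -[lift_word _ _ _]/(segment (first (tgt a)) l) big_nil mulr1.
have [-> //|al] := eqVneq (tgt a) (tag l).
rewrite segment0; last exact/eqP.
rewrite -(triv_segment _ l) mulrA arrow_mul_triv ifF ?mul0r ?mulr0 //.
by apply/negP => /eqP/first_inj/eqP; apply/negP.
Qed.

Lemma ext_lift_ext_map k l b : (forall i : vertex Q, b@_(triv_path i) = 0) ->
  ext_lift k l b =
  segment k (last (tag k)) * ext_map hn b * segment (first (tag l)) l.
Proof.
move=> h; rewrite {1 2}(pa_sumE b) !linear_sum mulr_sumr mulr_suml.
apply: eq_big_seq => q qb; rewrite !linearZ /= -pa_scalerAr -pa_scalerAl.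
congr (_ *: _); rewrite ext_map_path ext_lift_path /ext_path.
case Es: (parrows q) => [|a s].
  by have := supp_triv qb Es; rewrite h eqxx.
have [q' [qs qs' qa' _ _]] := path_uncons K Es.
have as_ : is_path (tgt a) s by rewrite -qs' -qa'; exact: valP q'.
rewrite /= -!mulrA (mulrA _ _ (segment _ l)) -lift_word_ext_word // qs.
have [<- //|ak] := eqVneq (src a) (tag k).
rewrite -(segment_triv k) -!mulrA (mulrA (triv _)) triv_mul_arrow.
rewrite ifF ?mul0r ?mulr0 //.
by apply/negP => /eqP/last_inj/eqP; apply/negP.
Qed.

Lemma ext_path_triv (q : qpath Q) :
  ext_path hn K q * triv (first (ptgt q) : vertex Q') = ext_path hn K q.
Proof.
rewrite /ext_path /ptgt; have := valP q; rewrite -/(psrc q) -/(parrows q).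
case: (parrows q) => [|a s]; first by rewrite mul0r.
case/andP=> _; elim: s a => [|b s IH] a /=.
  by rewrite big_nil mulr1 arrow_mul_triv eqxx.
case/andP => _ bs; rewrite big_cons -!mulrA.
by have := IH b bs; rewrite /pend /= -!mulrA => ->.
Qed.

Lemma triv_ext_path (q : qpath Q) :
  triv (last (psrc q) : vertex Q') * ext_path hn K q = ext_path hn K q.
Proof.
rewrite /ext_path; have := valP q; rewrite -/(psrc q) -/(parrows q).
case: (parrows q) => [|a s] /=; first by rewrite mulr0.
by case/andP => /eqP <- _; rewrite mulrA triv_mul_arrow eqxx.
Qed.

(** At the vertices (i, n_i) and (j, 1) the outer pieces of chain are trivial,
    so that lifting is then the extension map on the part of KQ between i
    and j. *)
Lemma ext_map_sum_lift b : (forall i : vertex Q, b@_(triv_path i) = 0) ->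
  ext_map hn b = \sum_i \sum_j ext_lift (last i) (first j) b.
Proof.
move=> h; have -> : \sum_i \sum_j ext_lift (last i) (first j) b =
  (\sum_i triv (last i : vertex Q')) * ext_map hn b *
  (\sum_j triv (first j : vertex Q')).
  rewrite !mulr_suml; apply: eq_bigr => i _; rewrite mulr_sumr.
  by apply: eq_bigr => j _; rewrite (ext_lift_ext_map _ _ h) !segment_refl.
move: b {h}; apply: path_alg_ind => [|c x y ex ey|q].
- by rewrite linear0 mulr0 mul0r.
- by rewrite linearP /= mulrDr mulrDl -!(pa_scalerAr, pa_scalerAl) -ex -ey.
rewrite ext_map_path (mulr_suml _ _ _ (ext_path hn K q)).
rewrite (bigD1 (psrc q)) //= triv_ext_path [X in _ + X]big1 ?addr0; last first.
  move=> i iq; rewrite -triv_ext_path mulrA triv_mul_triv ifF ?mul0r //.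
  by apply/negP => /eqP/last_inj/eqP; apply/negP.
rewrite mulr_sumr (bigD1 (ptgt q)) //= ext_path_triv big1 ?addr0 //.
move=> i iq; rewrite -ext_path_triv -mulrA triv_mul_triv ifF ?mulr0 //.
by apply/negP => /eqP/first_inj/esym/eqP; apply/negP.
Qed.

End Extension.

(** * Trivial paths and the radical *)

Section JacobsonUnit.
Variables (K : fieldType) (R : falgType K) (m : nat) (e : 'I_m -> R).
Hypothesis he : complete_primitive_idempotents e.

Lemma exists_maximal_right_ideal (B : {vspace R}) : B != 0%VS ->
  exists M, maximal_right_ideal B M.
Proof.
move=> B0.
pose D k := `[< exists M, [/\ right_ideal B M, M != B & \dim M = k] >].
have D0 : exists k, D k.
  exists 0%N; apply/asboolP; exists 0%VS.
  by rewrite /right_ideal prod0v !sub0v eq_sym dimv0.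
have Dle k : D k -> (k <= \dim B)%N.
  by move=> /asboolP[M [/andP[MB _] _ <-]]; apply: dimvS.
case: (ex_maxnP D0 Dle) => k /asboolP[M [rM MB dM]] kmax.
exists M; split=> // U rU MU; have [|UB] := eqVneq U B; first by right.
left; apply/eqP; rewrite eq_sym eqEdim MU dM; apply: kmax.
by apply/asboolP; exists U.
Qed.

(** A maximal right ideal of Q_i is proper, so it does not contain the unit. *)
Lemma idem_notin_jacobson i : e i \notin jacobson (corner e i).
Proof.
have e0 : e i != 0 by have [/(_ i) []] := he.
have [|M mM] := @exists_maximal_right_ideal (corner e i).
  by apply: contraNneq e0 => C0; have := e_corner he i; rewrite C0 memv0.
apply/negP => /jacobsonP[_ /(_ M mM) eM].
have [/andP[MB /subvP MBM] /eqP MnB _] := mM; case: MnB.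
apply/eqP; rewrite eqEsubv MB; apply/subvP => y yB.
by rewrite -(peirce_id_l he yB); apply: MBM; apply: memv_mul.
Qed.

End JacobsonUnit.

Section Presentation.
Variables (K : fieldType) (R : falgType K) (m : nat) (e : 'I_m -> R).
Hypotheses (he : complete_primitive_idempotents e) (hb : basic e).
Variable d : 'I_m -> 'I_m -> nat.
Local Notation Q := (mult_quiver d).
Local Notation triv := (triv_elt K).
Local Notation arr := (arrow_elt K).
Variable phi : {linear path_alg K Q -> R}.
Hypothesis phi_alg : monoid_morphism phi.
Hypothesis phi_triv : forall i : vertex Q, phi (triv i) = e i.
Hypothesis phi_arrow : forall a : arrow Q,
  phi (arr a) \in arrow_space e (src a) (tgt a).
Hypothesis phi_surj : forall r : R, exists a, phi a = r.

Let phiM : {morph phi : a b / a * b} := phi_alg.2.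

Lemma phi_path_peirce (q : qpath Q) :
  phi (pa_path K q) \in peirce e (psrc q) (ptgt q).
Proof.
apply/(mem_peirce he); rewrite -!phi_triv -!phiM.
by rewrite triv_mul_path eqxx path_mul_triv eqxx.
Qed.

(** Either the first arrow is a loop, sent into J(Q_i) by phi, or the cycle
    leaves i and its image lies in some A_ik A_ki, which is contained in J(Q_i)
    as R is basic. *)
Lemma phi_cycle_jacobson (q : qpath Q) : parrows q != [::] ->
  ptgt q = psrc q -> phi (pa_path K q) \in jacobson (corner e (psrc q)).
Proof.
case Es: (parrows q) => [|a s] // _ qq.
have [p [qa pa _ pq ->]] := path_uncons K Es; rewrite phiM qa.
have pP := phi_path_peirce p; rewrite pq qq qa pa in pP.
have aP := phi_arrow a; rewrite /arrow_space in aP.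
have [ai|ai] := eqVneq (src a) (tgt a).
  rewrite ai eqxx in aP *; rewrite ai in pP.
  exact: (jacobson_mulr (corner_mul he _) aP pP).
rewrite (negPf ai) in aP; apply: (peirce_jacobson he hb) aP pP.
by rewrite eq_sym.
Qed.

(** Modulo J(Q_i) only the trivial path at i counts. *)
Lemma phi_corner_jacobson (i : vertex Q) a :
  phi (triv i * a * triv i) - a@_(triv_path i) *: e i \in jacobson (corner e i).
Proof.
move: a; apply: path_alg_ind => [|c a b ha hb'|q].
- by rewrite mulr0 mul0r linear0 pa_coef0 scale0r subr0 mem0v.
- rewrite mulrDr mulrDl -!(pa_scalerAr, pa_scalerAl) linearP /=.
  rewrite pa_coefD pa_coefZ scalerDl -scalerA opprD addrACA -scalerBr.
  by rewrite memvD // memvZ.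
rewrite pa_coef_path triv_mul_path.
have [q0|q0] := eqVneq (parrows q) [::].
  rewrite {2 3}(path_nil q0) -[triv_path _ == _]/((psrc q, [::]) == (i, [::])).
  rewrite xpair_eqE eqxx andbT; have [qi|qi] := eqVneq (psrc q) i; last first.
    by rewrite mul0r linear0 scale0r subr0 mem0v.
  by rewrite qi triv_mul_triv eqxx phi_triv scale1r subrr mem0v.
rewrite [q == _]negbTE ?scale0r ?subr0; last first.
  by apply: contraNneq q0 => ->.
have [qi|_] := eqVneq (psrc q) i; last by rewrite mul0r linear0 mem0v.
rewrite path_mul_triv; have [qi'|_] := eqVneq (ptgt q) i; last first.
  by rewrite linear0 mem0v.
by rewrite -qi; apply: phi_cycle_jacobson => //; rewrite qi.
Qed.

Lemma coef_triv_eq0 i a : e i * phi a * e i \in jacobson (corner e i) ->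
  a@_(triv_path (i : vertex Q)) = 0.
Proof.
move=> aJ; have := phi_corner_jacobson i a; rewrite !phiM phi_triv => dJ.
have : a@_(triv_path (i : vertex Q)) *: e i \in jacobson (corner e i).
  by rewrite -[_ *: _](subKr (e i * phi a * e i)) memvB.
apply: contraTeq => c0.
apply: contra (idem_notin_jacobson he i) => cJ.
by rewrite -(scalerK c0 (e i)) memvZ.
Qed.

Variables (n : 'I_m -> nat) (hn : forall i, (0 < n i)%N).
Local Notation Q' := (ext_quiver d hn).
Local Notation V := {i : 'I_m & 'I_(n i)}.
Local Notation triv' := (triv_elt K : vertex Q' -> path_alg K Q').
Implicit Types k l : V.

(** * The homomorphism onto the block extension *)

Definition block_coef k l (x : path_alg K Q') : R :=
  phi (collapse_map (triv' k * x * triv' l)).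

Lemma block_coef_linear k l : linear (block_coef k l).
Proof.
move=> c x y; rewrite /block_coef mulrDr mulrDl -!(pa_scalerAr, pa_scalerAl).
by rewrite !linearP /= ?linearP.
Qed.
HB.instance Definition _ k l :=
  GRing.isLinear.Build K (path_alg K Q') R *:%R (block_coef k l)
    (block_coef_linear k l).

Lemma block_coefM k l x y :
  block_coef k l (x * y) = \sum_(r : V) block_coef k r x * block_coef r l y.
Proof.
rewrite /block_coef -[x in LHS]mulr1 -(sum_triv K Q') mulr_sumr.
rewrite mulr_suml mulr_sumr mulr_suml !linear_sum.
apply: eq_bigr => r _; rewrite -phiM; congr (phi _).
rewrite -(mulrA (triv' r)) -collapse_mapM; congr collapse_map.
by rewrite -!mulrA; congr (_ * (_ * _)); rewrite !mulrA triv_mul_triv eqxx.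
Qed.

Lemma block_coef1 k l : block_coef k l 1 = if k == l then e (tag k) else 0.
Proof.
rewrite /block_coef mulr1 triv_mul_triv; case: eqP => [->|_].
  by rewrite collapse_map_triv phi_triv.
by rewrite !linear0.
Qed.

(** If k and l lie over the same vertex of Q and l precedes k, then a path from
    k to l is not made of deltas only, so phi sends what is left of it into the
    radical. *)
Lemma block_coef_mem k l x :
  block_coef k l x \in block_entry e (tagged k) (tagged l).
Proof.
move: x; apply: path_alg_ind => [|c x y hx hy|p].
- by rewrite linear0 mem0v.
- by rewrite linearP memvD // memvZ.
rewrite /block_coef triv_mul_path; case: eqP => [pk|_]; last first.
  by rewrite mul0r !linear0 mem0v.
rewrite path_mul_triv; case: eqP => [pl|_]; last by rewrite !linear0 mem0v.
rewrite collapse_map_path; have := phi_path_peirce (collapse p).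
have -> : psrc (collapse p) = tag k by rewrite -pk.
rewrite ptgt_collapse pl /block_entry; case: eqP => [kl|//].
case: leqP => [_|lk _]; first by rewrite -kl.
have := @phi_cycle_jacobson (collapse p).
have -> : psrc (collapse p) = tag k by rewrite -pk.
rewrite ptgt_collapse pl; apply; last exact: esym.
apply/eqP => p0; have := reaches_delta_path (valP p) p0.
rewrite -/(psrc p) -/(parrows p) -/(ptgt p) pk pl /reaches => /andP[_].
by rewrite leqNgt lk.
Qed.

Lemma block_coef_lift k l k' l' b :
  (forall i : vertex Q, b@_(triv_path i) = 0) \/ reaches k l ->
  block_coef k' l' (ext_lift hn k l b) =
  if (k == k') && (l == l') then e (tag k) * phi b * e (tag l) else 0.
Proof.
move=> h; rewrite /block_coef -(ext_lift_src hn k l b).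
rewrite -(ext_lift_tgt hn k l) !mulrA.
rewrite triv_mul_triv (eq_sym k); have [kk|kk] := eqVneq k' k; last first.
  by rewrite !mul0r !linear0.
rewrite -!mulrA triv_mul_triv; have [<-|ll] := eqVneq l l'; last first.
  by rewrite !mulr0 !linear0.
by rewrite ext_lift_tgt ext_lift_src collapse_lift // !phiM !phi_triv mulrA.
Qed.

Definition block_matrix (x : path_alg K Q') : 'M[R]_(\sum_i n i) :=
  \matrix_(k, l) block_coef (tagnat.sig k) (tagnat.sig l) x.

Lemma block_matrix_mem x : block_mem e (block_matrix x).
Proof. by apply/block_memP => k l; rewrite mxE; apply: block_coef_mem. Qed.

Definition block_map (x : path_alg K Q') : block_ext he hb n :=
  BlockExt he hb (block_matrix_mem x).

Lemma block_map_linear : linear block_map.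
Proof.
move=> c x y; apply: block_ext_inj; apply/matrixP => k l.
by rewrite block_valD !mxE linearP.
Qed.
HB.instance Definition _ :=
  GRing.isLinear.Build K (path_alg K Q') (block_ext he hb n) *:%R block_map
    block_map_linear.

Lemma block_map_monoid : monoid_morphism block_map.
Proof.
split=> [|x y]; apply: block_ext_inj; apply/matrixP => k l; rewrite !mxE.
  by rewrite block_coef1 (inj_eq tagnat.sig_inj); case: eqP.
rewrite block_coefM (reindex tagnat.sig) /=; last exact/onW_bij/tagnat.sig_bij.
by apply: eq_bigr => r _; rewrite !mxE.
Qed.

(** The sum of the lifts of preimages b k l of the entries of M works, as soon
    as these lifts do not lose a trivial path. *)
Lemma block_map_surj M : exists x, block_map x = M.
Proof.
have eij i j : i != j -> e i * e j = 0 by have [_ + _] := he; apply.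
have preim (k l : V) :
    exists b, phi b = block_val M (tagnat.rank k) (tagnat.rank l).
  exact: phi_surj.
pose b k l := sval (cid (preim k l)).
have bE k l : phi (b k l) = block_val M (tagnat.rank k) (tagnat.rank l).
  exact: svalP (cid (preim k l)).
exists (\sum_k \sum_l ext_lift hn k l (b k l)).
have bmem k l : phi (b k l) \in block_entry e (tagged k) (tagged l).
  rewrite bE; have := block_valP M (tagnat.rank k) (tagnat.rank l).
  by rewrite /tagnat.sig2 /tagnat.sig1 !tagnat.rankK.
have b_liftable k l :
    (forall i : vertex Q, (b k l)@_(triv_path i) = 0) \/ reaches k l.
  have [kl|nkl] := boolP (reaches k l); [by right | left => i].
  (* The part of phi (b k l) in the corner Q_i is 0 unless k and l both lie
     over i; then l precedes k, and this part is in J(Q_i). *)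
  apply: coef_triv_eq0; have := bmem k l; rewrite /block_entry.
  case: eqP => [kl|kl].
    rewrite ifN; last by apply: contra nkl => le; rewrite /reaches le kl eqxx.
    move=> bJ; have bP := subvP (jacobson_sub _) _ bJ.
    have [<-|ik] := eqVneq (tag k) i.
      by rewrite (peirce_id_l he bP) (peirce_id_r he bP).
    rewrite -(peirce_id_l he bP) mulrA.
    by rewrite eij ?mul0r ?mem0v // eq_sym.
  move=> bP; have [ik|ik] := eqVneq i (tag k).
    rewrite -(peirce_id_r he bP) -!mulrA.
    rewrite (eij (tag l)) ?mulr0 ?mem0v // ik.
    by apply/eqP => /esym.
  rewrite -(peirce_id_l he bP) !mulrA.
  by rewrite eij ?mul0r ?mem0v.
apply: block_ext_inj; apply/matrixP => k' l'; rewrite mxE linear_sum /=.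
set k := tagnat.sig k'; set l := tagnat.sig l'.
rewrite (bigD1 k) //= [X in _ + X]big1 ?addr0 => [|r rk]; last first.
  rewrite linear_sum big1 //= => u _.
  by rewrite block_coef_lift // (negPf rk).
rewrite linear_sum /= (bigD1 l) //=.
rewrite [X in _ + X]big1 ?addr0 => [|r rk]; last first.
  by rewrite block_coef_lift // (negPf rk) andbF.
rewrite block_coef_lift // !eqxx /=.
have bP := subvP (block_entry_sub _ _ _) _ (bmem k l).
by rewrite (peirce_id_l he bP) (peirce_id_r he bP) bE !tagnat.sigK.
Qed.

(** * The kernel *)

Variable S : path_alg K Q -> Prop.
Hypothesis S_gen : forall a, ideal_gen S a <-> phi a = 0.

Definition ext_relations (x : path_alg K Q') : Prop :=
  exists2 a, S a & x = ext_map hn a.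

(** The extension map kills the trivial paths; because of this lemma it loses
    nothing on Ker phi. *)
Lemma ker_coef_triv a (i : vertex Q) : phi a = 0 -> a@_(triv_path i) = 0.
Proof. by move=> a0; apply: coef_triv_eq0; rewrite a0 mulr0 mul0r mem0v. Qed.

Lemma block_map_ext_ideal x : ideal_gen ext_relations x -> block_map x = 0.
Proof.
have [_ bM] := block_map_monoid.
move/asboolP/(_ (fun y => block_map y = 0)); apply; first split.
- exact: linear0.
- by move=> a b a0 b0; rewrite linearD /= a0 b0 addr0.
- by move=> a b b0; rewrite bM b0 mulr0.
- by move=> a b a0; rewrite bM a0 mul0r.
move=> _ [a Sa ->]; have a0 : phi a = 0 by apply/S_gen/mem_ideal_gen.
have at0 i : a@_(triv_path (i : vertex Q)) = 0 by apply: ker_coef_triv.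
apply: block_ext_inj; apply/matrixP => k l; rewrite !mxE.
rewrite ext_map_sum_lift // linear_sum /= big1 // => i _.
rewrite linear_sum /= big1 // => j _; rewrite block_coef_lift; last by left.
by rewrite a0 mulr0 mul0r; case: ifP.
Qed.

(** The elements of Ker phi all of whose lifts lie in the ideal generated by the
    images of S form an ideal containing S.  It is necessary to consider all k
    and l at once, as multiplication by an arrow changes them. *)
Lemma lift_ker k l a : phi a = 0 -> ideal_gen ext_relations (ext_lift hn k l a).
Proof.
move=> a0; have [J0 JD Jl Jr] := @ideal_genP _ ext_relations.
have JZ c x : ideal_gen ext_relations x -> ideal_gen ext_relations (c *: x).
  by move=> Jx; rewrite -[x]mul1r pa_scalerAl; apply: Jl.
pose I b :=
  phi b = 0 /\ forall k l, ideal_gen ext_relations (ext_lift hn k l b).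
suff : I a by case.
have ID b c : I b -> I c -> I (b + c).
  move=> [b0 Ib] [c0 Ic]; split; first by rewrite linearD /= b0 c0 addr0.
  by move=> k' l'; rewrite linearD /=; apply: JD.
have IZ c b : I b -> I (c *: b).
  move=> [b0 Ib]; split; first by rewrite linearZ /= b0 scaler0.
  by move=> k' l'; rewrite linearZ /=; apply: JZ.
have I0 : I 0 by split=> [|k' l']; rewrite linear0.
have /asboolP/(_ I) := (S_gen a).2 a0; apply; first split=> //.
- move=> b c Ic; move: b; apply: path_gen_ind.
  + by rewrite mul0r.
  + move=> z b b' hb1 hb2; rewrite mulrDl -pa_scalerAl.
    by apply: ID => //; apply: IZ.
  + move=> v; case: Ic => c0 Ic; split=> [|k' l'].
      by rewrite phiM c0 mulr0.
    by rewrite ext_lift_mul_triv_l; case: ifP.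
  move=> x b [b0 Ib]; rewrite -mulrA; split=> [|k' l'].
    by rewrite phiM b0 mulr0.
  by rewrite ext_lift_arrow_mul; apply: Jl.
- move=> b c; move: c b.
  apply: (path_gen_ind (P := fun c => forall b, I b -> I (b * c))).
  + by move=> b _; rewrite mulr0.
  + move=> z c c' hc1 hc2 b Ib; rewrite mulrDr -pa_scalerAr.
    by apply: ID; [apply/IZ/hc1|apply: hc2].
  + move=> v b [b0 Ib]; split=> [|k' l']; first by rewrite phiM b0 mul0r.
    by rewrite ext_lift_mul_triv_r; case: ifP.
  move=> x c hc b [b0 Ib]; rewrite mulrA; apply: hc; split=> [|k' l'].
    by rewrite phiM b0 mul0r.
  by rewrite ext_lift_mul_arrow; apply/Jr/Jr.
move=> s Ss; have s0 : phi s = 0 by apply/S_gen/mem_ideal_gen.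
split=> // k' l'; rewrite ext_lift_ext_map => [|i]; last exact: ker_coef_triv.
by apply/Jr/Jl/mem_ideal_gen; exists s.
Qed.

Lemma block_map_ker x : block_map x = 0 -> ideal_gen ext_relations x.
Proof.
move=> x0; rewrite -[x]sum_lift_collapse.
have [J0 JD _ _] := @ideal_genP _ ext_relations.
apply: (big_ind (ideal_gen ext_relations)) => // k _.
apply: (big_ind (ideal_gen ext_relations)) => // l _.
apply: lift_ker.
have := congr1 (fun M => block_val M (tagnat.rank k) (tagnat.rank l)) x0.
by rewrite !mxE !tagnat.rankK.
Qed.

End Presentation.

(** * The isomorphism *)

Theorem theorem3p3 (K : closedFieldType) (R : falgType K)
    (m : nat) (e : 'I_m -> R)
    (he : complete_primitive_idempotents e) (hb : basic e)
    (x : forall i j : 'I_m, 'I_(arrow_mult e i j) -> R)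
    (hx : forall i j : 'I_m,
       basis_modulo (arrow_space e i j) (composite_space e i j) (@x i j))
    (phi : {linear path_alg K (mult_quiver (arrow_mult e)) -> R})
    (phi_alg : monoid_morphism phi)
    (phi_triv : forall i : vertex (mult_quiver (arrow_mult e)),
       phi (triv_elt K i) = e i)
    (phi_arrow : forall (i j : 'I_m) (t : 'I_(arrow_mult e i j)),
       phi (arrow_elt K (mult_arrow t)) = x i j t)
    (phi_surj : forall r : R, exists a, phi a = r)
    (w : nat) (rho : 'I_w -> path_alg K (mult_quiver (arrow_mult e)))
    (rho_basic : forall k : 'I_w, basic_elt (rho k))
    (rho_gen : forall a, ideal_gen (fun b => exists k, b = rho k) a <-> phi a = 0)
    (n : 'I_m -> nat) (hn : forall i : 'I_m, (0 < n i)%N) :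
  exists f : {linear block_ext he hb n ->
                quot_alg (fun b => exists k, b = ext_map hn (rho k))},
    monoid_morphism f /\ bijective f.
Proof.
have phi_arrow_mem a : phi (arrow_elt K a) \in arrow_space e (src a) (tgt a).
  case: a => -[i j] t; have := phi_arrow i j t; rewrite /mult_arrow => ->.
  by have [+ _] := hx i j; apply.
set S' := fun b => exists k, b = ext_map hn (rho k).
set S := fun b => exists k, b = rho k.
have SE : ext_relations (hn := hn) S = S'.
  apply/funext => b; apply/propext; split=> [[_ [k ->] ->]|[k ->]].
    by exists k.
  by exists (rho k) => //; exists k.
pose Psi : {linear _ -> _} :=
  block_map he hb phi_alg phi_triv phi_arrow_mem (hn := hn).
have PsiK a : Psi a = 0 <-> ideal_gen S' a.
  rewrite -SE; split; first exact: block_map_ker.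
  exact: block_map_ext_ideal.
have [Psi1 PsiM] : monoid_morphism Psi by exact: block_map_monoid.
have Psi_surj M : exists a, Psi a = M by exact: block_map_surj.
(* The isomorphism sends M to the class of any preimage s M under Psi. *)
pose s M := sval (cid (Psi_surj M)).
have sK M : Psi (s M) = M by exact: svalP (cid (Psi_surj M)).
pose f M : quot_alg S' := quot_pi S' (s M).
have fE a : f (Psi a) = quot_pi S' a.
  by apply/quot_piP/PsiK; rewrite linearB /= sK subrr.
have f_lin : linear f.
  move=> c M N; rewrite -{1}(sK M) -{1}(sK N) -linearP fE raddfD.
  by congr (_ + _); rewrite -[LHS]quot_scaleE.
pose fL :=
  GRing.isLinear.Build K (block_ext he hb n) (quot_alg S') *:%R f f_lin.
pose F : {linear block_ext he hb n -> quot_alg S'} := HB.pack f fL.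
exists F; split.
  split=> [|M N] /=; first by rewrite -Psi1 fE.
  by rewrite -{1}(sK M) -{1}(sK N) -PsiM fE -[LHS]quot_mulE.
exists (fun z => Psi (repr z)) => [M|z] /=; last first.
  by rewrite fE /quot_pi reprK.
rewrite -[RHS]sK; apply/subr0_eq; rewrite -linearB /=.
by apply/PsiK; exact: quot_reprP.
Qed.
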